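(* Let $\Omega:=(0,1)$. Let $\alpha\in L_\infty(\mathbb{R};\mathbb{R})$ be $1$-periodic with $\alpha^{-1}\in L_\infty(\mathbb{R})$ and assume $\mathfrak{m}(\alpha^{-1})=0$; define $\alpha_n:=\alpha(n\cdot)$. Then $\alpha_n(\mathrm{m})$ holomorphically $G$-converges to the relation $\alpha_\infty:=\{0\}\times L_2(\Omega)$. In particular, $\sigma_{g_0(\Omega)}(\alpha_\infty)=\emptyset$.
   Context: $\mathfrak{m}(\beta):=\int_0^1\beta$; $\alpha_n(\mathrm{m})$ is the operator of multiplication by $\alpha_n$ on the complex Hilbert space $L_2(\Omega)$. $g_0(\Omega):=\{u';\ u\in H_0^1(\Omega)\}=\{1\}^\perp\subseteq L_2(\Omega)$, $\iota_0\colon g_0(\Omega)\hookrightarrow L_2(\Omega)$ is the canonical embedding and $\iota_0^*$ the orthogonal projection onto $g_0(\Omega)$, viewed as a map into $g_0(\Omega)$. Holomorphic $G$-convergence: let $H=g_0(\Omega)$ and $a_n\in L(H)$ be such that there is an open $\omega\subseteq\bigcap_n\rho(a_n)$ with $0\in\overline\omega$ and $\sup_n\sup_{\lambda\in K}\|(a_n-\lambda)^{-1}\|<\infty$ for all compact $K\subseteq\omega$. Let $\mathcal{G}$ be the set of $\phi\in H$ for which (a) there is a holomorphic $f_\phi\colon\omega\to H$ with $\langle\psi,(a_n-\cdot)^{-1}\phi\rangle\to\langle\psi,f_\phi(\cdot)\rangle$ uniformly on compact subsets of $\omega$ for all $\psi\in H$, and (b) $f_\phi$ admits a holomorphic extension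 to $0$. $(a_n)_n$ holomorphically $G$-converges (on $\omega$) to a relation $a\subseteq H\times H$ if $\mathcal{G}$ is dense in $H$ and $a^{-1}=\{(\phi,\psi)\in\mathcal{G}\times H;\ \psi=f_\phi(0)\}$. For coefficients: $\tilde a_n\in L_\infty(\Omega)$ holomorphically $G$-converges to a relation $\tilde a\subseteq L_2(\Omega)\times L_2(\Omega)$ if $(\iota_0^*\tilde a_n\iota_0)_n$ holomorphically $G$-converges to some $a\subseteq H\times H$ with $a^{-1}=(\iota_0^*\tilde a\iota_0)^{-1}$, where $\iota_0^*\tilde a\iota_0=\{(\phi,\iota_0^*q);\ \phi\in g_0(\Omega),\ (\iota_0\phi,q)\in\tilde a\}$. Here one takes $\omega=(\mathbb{C}\setminus\mathbb{R})\cup\{\lambda\in\mathbb{R};\lambda>\|\alpha\|_\infty\}$ together with a neighbourhood of the latter half-line contained in $(\mathbb{C}\setminus\mathbb{R})\cup(\|\alpha\|_\infty,\infty)$, i.e. $\omega=(\mathbb{C}\setminus\mathbb{R})\cup(\|\alpha\|_\infty,\infty)$. For a relation $\tilde a\subseteq L_2(\Omega)\times L_2(\Omega)$ the inner spectrum $\sigma_{g_0(\Omega)}(\tilde a)$ is the set of $\lambda\in\mathbb{C}$ for which $(\iota_0^*\tilde a\iota_0-\lambda)^{-1}$ is not (the graph of) an everywhere defined bounded linear operator on $g_0(\Omega)$. *)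

(* Defs.v *)
From HB Require Import structures.
From mathcomp Require Import all_boot all_order all_algebra.
From mathcomp Require Import sesquilinear complex.
From mathcomp Require Import all_classical all_reals all_analysis.
From mathcomp Require Import measurable_realfun.
From mathcomp Require Import ring lra.

Set Implicit Arguments.
Unset Strict Implicit.
Unset Printing Implicit Defensive.

Import Order.TTheory GRing.Theory Num.Theory.
Import numFieldNormedType.Exports.

Local Open Scope classical_set_scope.
Local Open Scope ring_scope.

Local Notation Re := complex.Re.
Local Notation Im := complex.Im.

Section DotNorm.
Variables (C : numClosedFieldType) (U : lmodType C) (dot : {dot U for Num.conj}).
Local Notation "''[' u , v ]" := (dot u v) : ring_scope.
Local Notation "''[' u ]" := '[u, u] : ring_scope.

Definition dot_norm (u : U) : C := sqrtC '[u].

Lemma dot_CauchySchwarz u v : `|'[u, v]| ^+ 2 <= '[u] * '[v].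
Proof.
have [->|v0] := eqVneq v 0.
  rewrite !linear0r normr0 expr0n/=.
  exact: lexx.
have vv0 : 0 < '[v] by rewrite dnorm_gt0.
pose d := '[u, v]; pose a := d / '[v].
have vu : '[v, u] = d^* by rewrite hermC expr0 mul1r.
have vv : '[v]^* = '[v] by rewrite (CrealP _)// ger0_real// ltW.
have : 0 <= '[u - a *: v] by exact: dnorm_ge0.
rewrite dnormB dnormZ linearZr_LR/= -/d.
have -> : `|a| ^+ 2 * '[v] = `|d| ^+ 2 / '[v].
  rewrite normrM exprMn normfV (gtr0_norm vv0) -mulrA; congr (_ * _).
  by rewrite expr2 -mulrA mulVf ?gt_eqF// mulr1.
have -> : a^* * d = `|d| ^+ 2 / '[v].
  by rewrite rmorphM fmorphV/= vv mulrAC normCKC.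
have -> : (`|d| ^+ 2 / '[v])^* = `|d| ^+ 2 / '[v].
  by rewrite rmorphM fmorphV/= vv rmorphXn/= conj_normC.
rewrite opprD addrACA subrr addr0 subr_ge0.
by rewrite ler_pdivrMr.
Qed.

Lemma ler_dot_normD u v : dot_norm (u + v) <= dot_norm u + dot_norm v.
Proof.
have p w : 0 <= dot_norm w by rewrite sqrtC_ge0 dnorm_ge0.
rewrite -(ler_pXn2r (ltn0Sn 1)) ?nnegrE ?addr_ge0//.
rewrite sqrrD !sqrtCK dnormD addrAC lerD2r lerD2l.
have cs : `|'[u, v]| <= dot_norm u * dot_norm v.
  rewrite -(ler_pXn2r (ltn0Sn 1)) ?nnegrE ?mulr_ge0// exprMn !sqrtCK.
  exact: dot_CauchySchwarz.
have -> : '[u, v] + '[u, v]^* = 'Re '[u, v] *+ 2.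
  by rewrite ReE -[RHS]mulr_natr divfK ?pnatr_eq0.
rewrite lerMn2r/=; apply: le_trans cs.
apply: le_trans (real_ler_norm _) _; first exact: Creal_Re.
rewrite -(ler_pXn2r (ltn0Sn 1)) ?nnegrE// real_normK ?Creal_Re//.
by rewrite normC2_Re_Im lerDl real_exprn_even_ge0// Creal_Im.
Qed.

Lemma dot_normZ a u : dot_norm (a *: u) = `|a| * dot_norm u.
Proof.
rewrite /dot_norm dnormZ rootCMl ?exprn_ge0//.
by rewrite sqrCK.
Qed.

Lemma dot_norm0_eq0 u : dot_norm u = 0 -> u = 0.
Proof. by move=> /eqP; rewrite sqrt_dnorm_eq0 => /eqP. Qed.

End DotNorm.

Local Open Scope complex_scope.

Section CIntegral.
Variable R : realType.
Local Notation C := R[i].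
Local Notation T := (measurableTypeR R).
Local Notation mu := (@lebesgue_measure R).

Definition Omega : set T := `]0, 1[.

Lemma measurable_Omega : measurable Omega.
Proof. exact: measurable_itv. Qed.
Hint Resolve measurable_Omega : core.

Definition cmeasurable (f : T -> C) : Prop :=
  measurable_fun Omega (@complex.Re R \o f) /\ measurable_fun Omega (@complex.Im R \o f).

Definition cintegrable (f : T -> C) : Prop :=
  mu.-integrable Omega (EFin \o (@complex.Re R \o f)) /\
  mu.-integrable Omega (EFin \o (@complex.Im R \o f)).

Definition cint (f : T -> C) : C :=
  (\int[mu]_(x in Omega) Re (f x)) +i* (\int[mu]_(x in Omega) Im (f x)).

Definition sqmod (z : C) : R := Re z ^+ 2 + Im z ^+ 2.

Definition sqint : {pred T -> C} :=
  [pred f | `[< cmeasurable f /\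
                mu.-integrable Omega (fun x => (sqmod (f x))%:E) >]].

Lemma cintD f g : cintegrable f -> cintegrable g ->
  cint (f \+ g) = cint f + cint g.
Proof.
move=> [rf if_] [rg ig]; rewrite /cint; apply/eqP; rewrite eq_complex/=.
apply/andP; split; apply/eqP; rewrite -RintegralD//.
- by apply: eq_Rintegral => x _; case: (f x) (g x) => [? ?] [? ?].
- by apply: eq_Rintegral => x _; case: (f x) (g x) => [? ?] [? ?].
Qed.

Lemma integrableZl' (a : R) (f : T -> R) :
  mu.-integrable Omega (EFin \o f) ->
  mu.-integrable Omega (fun x => (a * f x)%:E).
Proof.
move=> fi; apply: eq_integrable (integrableZl measurable_Omega a fi) => //.
Qed.

Lemma cintegrableZ a f : cintegrable f -> cintegrable (a \*o f).
Proof.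
case: a => a b [rf if_]; split.
  apply: (eq_integrable measurable_Omega
    (fun x => (a * Re (f x))%:E - (b * Im (f x))%:E)%E).
    by move=> x _ /=; case: (f x).
  by apply: integrableB => //; exact: integrableZl'.
apply: (eq_integrable measurable_Omega
    (fun x => (a * Im (f x))%:E + (b * Re (f x))%:E)%E).
  by move=> x _ /=; case: (f x).
by apply: integrableD => //; exact: integrableZl'.
Qed.

Lemma cintZ a f : cintegrable f -> cint (a \*o f) = a * cint f.
Proof.
case: a => a b [rf if_]; rewrite /cint; apply/eqP; rewrite eq_complex/=.
apply/andP; split; apply/eqP; rewrite -!RintegralZl//.
- rewrite -RintegralB//; try exact: integrableZl'.
  by apply: eq_Rintegral => x _; case: (f x).
- rewrite -RintegralD//; try exact: integrableZl'.
  by apply: eq_Rintegral => x _; case: (f x).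
Qed.

Lemma cint_conj f : cintegrable f -> cint (fun x => (f x)^*%C) = (cint f)^*%C.
Proof.
move=> [rf if_]; rewrite /cint/=; congr (_ +i* _).
  by apply: eq_Rintegral => x _; case: (f x).
rewrite -mulN1r -RintegralZl//; apply: eq_Rintegral => x _.
by case: (f x) => ? ? /=; rewrite mulN1r.
Qed.

Lemma ae_eq_cint f g : cmeasurable f -> cmeasurable g ->
  f = g %[ae mu in Omega] -> cint f = cint g.
Proof.
move=> [rf if_] [rg ig] fg; rewrite /cint /Rintegral; congr (fine _ +i* fine _).
- apply: ae_eq_integral => //.
  + exact/measurable_EFinP.
  + exact/measurable_EFinP.
  + by move: fg; apply: filterS => x /[apply] /= ->.
- apply: ae_eq_integral => //.
  + exact/measurable_EFinP.
  + exact/measurable_EFinP.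
  + by move: fg; apply: filterS => x /[apply] /= ->.
Qed.

Lemma cmeasurableD f g : cmeasurable f -> cmeasurable g ->
  cmeasurable (f \+ g).
Proof.
move=> [rf if_] [rg ig]; split.
- apply: (eq_measurable_fun (fun x => Re (f x) + Re (g x))).
    by move=> x _ /=; case: (f x) (g x) => [? ?] [? ?].
  exact: measurable_funD.
- apply: (eq_measurable_fun (fun x => Im (f x) + Im (g x))).
    by move=> x _ /=; case: (f x) (g x) => [? ?] [? ?].
  exact: measurable_funD.
Qed.

Lemma cmeasurableM f g : cmeasurable f -> cmeasurable g ->
  cmeasurable (f \* g).
Proof.
move=> [rf if_] [rg ig]; split.
- apply: (eq_measurable_fun (fun x => Re (f x) * Re (g x) - Im (f x) * Im (g x))).
    by move=> x _ /=; case: (f x) (g x) => [? ?] [? ?].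
  by apply: measurable_funB; exact: measurable_funM.
- apply: (eq_measurable_fun (fun x => Re (f x) * Im (g x) + Im (f x) * Re (g x))).
    by move=> x _ /=; case: (f x) (g x) => [? ?] [? ?].
  by apply: measurable_funD; exact: measurable_funM.
Qed.

Lemma cmeasurable_cst c : cmeasurable (cst c).
Proof. by split; exact: measurable_cst. Qed.

Lemma cmeasurable_conj f : cmeasurable f -> cmeasurable (fun x => (f x)^*%C).
Proof.
move=> [rf if_]; split.
- apply: (eq_measurable_fun (fun x => Re (f x))) => //.
  by move=> x _ /=; case: (f x).
- apply: (eq_measurable_fun (fun x => - Im (f x))).
    by move=> x _ /=; case: (f x).
  exact: measurable_funN.
Qed.

Lemma cmeasurable_sqmod f : cmeasurable f ->
  measurable_fun Omega (fun x => (sqmod (f x))%:E).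
Proof.
move=> [rf if_]; apply/measurable_EFinP.
by apply: measurable_funD; exact: measurable_funX.
Qed.

Lemma sqmod_ge0 z : 0 <= sqmod z.
Proof. by rewrite addr_ge0 ?sqr_ge0. Qed.

Lemma sqintP f : reflect (cmeasurable f /\
  mu.-integrable Omega (fun x => (sqmod (f x))%:E)) (f \in sqint).
Proof. exact: asboolP. Qed.

Lemma sqmod_mulJ z w :
  `|Re (z * w^*%C)| <= sqmod z + sqmod w /\
  `|Im (z * w^*%C)| <= sqmod z + sqmod w.
Proof.
case: z w => [a b] [c d]; rewrite /sqmod/=.
have [h1 h2 h3 h4] := And4 (sqr_ge0 (a + c)) (sqr_ge0 (a - c))
  (sqr_ge0 (b + d)) (sqr_ge0 (b - d)).
have [k1 k2 k3 k4] := And4 (sqr_ge0 (a + d)) (sqr_ge0 (a - d))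
  (sqr_ge0 (b + c)) (sqr_ge0 (b - c)).
have [a2 b2 c2 d2] := And4 (sqr_ge0 a) (sqr_ge0 b) (sqr_ge0 c) (sqr_ge0 d).
by rewrite !ler_norml; split; apply/andP; split; lra.
Qed.

Lemma sqint_cintegrable f g : f \in sqint -> g \in sqint ->
  cintegrable (fun x => f x * (g x)^*%C).
Proof.
move=> /sqintP[mf fi] /sqintP[mg gi].
have [rm im] := cmeasurableM mf (cmeasurable_conj mg).
have h := integrableD measurable_Omega fi gi.
have [hr hi] := (fun x => (sqmod_mulJ (f x) (g x)).1,
                 fun x => (sqmod_mulJ (f x) (g x)).2).
split; apply: le_integrable h => //; try exact/measurable_EFinP.
  move=> x _; rewrite /= lee_fin.
  by rewrite [leRHS]ger0_norm ?addr_ge0 ?sqr_ge0//; exact: hr.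
move=> x _; rewrite /= lee_fin.
by rewrite [leRHS]ger0_norm ?addr_ge0 ?sqr_ge0//; exact: hi.
Qed.

Lemma sqmod_axpy a z w :
  sqmod (a * z + w) <= 2 * sqmod a * sqmod z + 2 * sqmod w.
Proof.
case: a z w => [a b] [c d] [p q]; rewrite /sqmod/= -subr_ge0.
set u := a * c - b * d; set v := a * d + b * c.
have -> : 2 * (a ^+ 2 + b ^+ 2) * (c ^+ 2 + d ^+ 2) + 2 * (p ^+ 2 + q ^+ 2) -
    ((u + p) ^+ 2 + (v + q) ^+ 2) = (u - p) ^+ 2 + (v - q) ^+ 2.
  by rewrite /u /v; ring.
by rewrite addr_ge0 ?sqr_ge0.
Qed.

Lemma sqint_submod_closed : submod_closed sqint.
Proof.
split.
  apply/sqintP; split; first exact: cmeasurable_cst.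
  apply: (eq_integrable measurable_Omega (cst 0%E)); last exact: integrable0.
  by move=> x _ /=; rewrite /sqmod/= expr0n addr0.
move=> a f g /sqintP[mf fi] /sqintP[mg gi]; apply/sqintP.
have m : cmeasurable (a *: f + g).
  exact: (cmeasurableD (cmeasurableM (cmeasurable_cst a) mf) mg).
split=> //.
have := integrableD measurable_Omega
  (integrableZl' (2 * sqmod a) fi) (integrableZl' 2 gi).
apply: le_integrable => //; first exact: cmeasurable_sqmod.
move=> x _; have := sqmod_axpy a (f x) (g x).
rewrite /= lee_fin ger0_norm ?sqmod_ge0// => /le_trans; apply.
exact: ler_norm.
Qed.

End CIntegral.

Local Open Scope quotient_scope.

Section L2space.
Variable R : realType.
Local Notation C := R[i].
Local Notation T := (measurableTypeR R).
Local Notation mu := (@lebesgue_measure R).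

HB.instance Definition _ := GRing.isSubmodClosed.Build C (T -> C)
  (@sqint R) (@sqint_submod_closed R).

Record sqfun := SqFun { sqfun_val :> T -> C; _ : sqfun_val \in @sqint R }.
HB.instance Definition _ := [isSub for sqfun_val].
HB.instance Definition _ := [Choice of sqfun by <:].
HB.instance Definition _ := [SubChoice_isSubLmodule of sqfun by <:].

Definition sqnull : {pred sqfun} :=
  [pred f : sqfun | `[< \forall x \ae mu, Omega x -> f x = 0 >]].

Lemma sqnullP (f : sqfun) :
  reflect (\forall x \ae mu, Omega x -> f x = 0) (f \in sqnull).
Proof. exact: asboolP. Qed.

Lemma sqfunB (f g : sqfun) x : (f - g) x = f x - g x.
Proof. by []. Qed.

Lemma sqnull_zmod_closed : zmod_closed sqnull.
Proof.
split=> [|f g /sqnullP f0 /sqnullP g0]; apply/sqnullP.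
  exact/nearW.
move: f0 g0; apply: filterS2 => x f0 g0 Ox.
by rewrite sqfunB f0// g0// subr0.
Qed.

HB.instance Definition _ := GRing.isZmodClosed.Build sqfun sqnull
  sqnull_zmod_closed.

Definition L2 : Type := Quotient.quot sqnull.
HB.instance Definition _ := GRing.Zmodule.on L2.
HB.instance Definition _ := EqQuotient.on L2.

(* Two representatives define the same element iff they agree a.e. on Omega. *)
Lemma L2_eqP (f g : sqfun) :
  \pi_L2 f = \pi_L2 g <-> (\forall x \ae mu, Omega x -> f x = g x).
Proof.
split.
  move=> /eqP; rewrite -Quotient.idealrBE => /sqnullP; apply: filterS => x h Ox.
  by apply/eqP; rewrite -subr_eq0 -sqfunB; apply/eqP; exact: h.
move=> h; apply/eqP; rewrite -Quotient.idealrBE; apply/sqnullP.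
by move: h; apply: filterS => x h Ox; rewrite sqfunB h// subrr.
Qed.

Definition L2_fun (u : L2) : T -> C := repr u.

Definition L2_scale (a : C) (u : L2) : L2 := \pi_L2 (a *: repr u).

Lemma repr_piE (f : sqfun) :
  \forall x \ae mu, Omega x -> repr (\pi_L2 f) x = f x.
Proof. by apply/L2_eqP; rewrite reprK. Qed.

Lemma pi_scale a (f : sqfun) : \pi_L2 (a *: f) = L2_scale a (\pi_L2 f).
Proof.
apply/L2_eqP; have := repr_piE f; apply: filterS => x h Ox.
by rewrite /= /GRing.scale/= h.
Qed.

Lemma L2_scaleA a b u : L2_scale a (L2_scale b u) = L2_scale (a * b) u.
Proof. by rewrite -[u]reprK -(pi_scale b) -!pi_scale scalerA. Qed.

Lemma L2_scale1 : left_id 1 L2_scale.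
Proof. by move=> u; rewrite -[u]reprK -!pi_scale scale1r. Qed.

Lemma L2_scaleDr : right_distributive L2_scale +%R.
Proof.
move=> a u v; rewrite -[u]reprK -[v]reprK -raddfD -!pi_scale.
by rewrite scalerDr raddfD.
Qed.

Lemma L2_scaleDl u : {morph L2_scale^~ u : a b / a + b}.
Proof. by move=> a b /=; rewrite -[u]reprK -!pi_scale scalerDl raddfD. Qed.

HB.instance Definition _ := GRing.Zmodule_isLmodule.Build C L2
  L2_scaleA L2_scale1 L2_scaleDr L2_scaleDl.

Lemma pi_scaleE a (f : sqfun) : \pi_L2 (a *: f) = a *: \pi_L2 f.
Proof. exact: pi_scale. Qed.

Definition L2_dot (u v : L2) : C := cint (fun x => repr u x * (repr v x)^*%C).

Lemma sqfun_cmeasurable (f : sqfun) : cmeasurable f.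
Proof. by case: f => f /= /sqintP[]. Qed.

Lemma sqfun_mulJ (f g : sqfun) : cintegrable (fun x => f x * (g x)^*%C).
Proof. by apply: sqint_cintegrable; exact: valP. Qed.

Lemma L2_dot_pi (f g : sqfun) :
  L2_dot (\pi_L2 f) (\pi_L2 g) = cint (fun x => f x * (g x)^*%C).
Proof.
have mJ (h k : sqfun) : cmeasurable (fun x => h x * (k x)^*%C).
  by apply: cmeasurableM; [|apply: cmeasurable_conj]; exact: sqfun_cmeasurable.
apply: ae_eq_cint => //.
have := repr_piE g; have := repr_piE f; apply: filterS2 => x hf hg Ox.
by rewrite hf// hg.
Qed.

Lemma L2_dotC (u v : L2) : L2_dot u v = (-1) ^+ false * Num.conj (L2_dot v u).
Proof.
rewrite expr0 mul1r -[u]reprK -[v]reprK !L2_dot_pi.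
rewrite [RHS](_ : _ = (cint (fun x => repr v x * (repr u x)^*%C))^*%C)//.
rewrite -cint_conj; last exact: sqfun_mulJ.
by congr cint; apply/funext => x; rewrite rmorphM/= conjcK mulrC.
Qed.

Lemma L2_dotl v : linear_for *%R (L2_dot^~ v).
Proof.
move=> a u w; rewrite -[u]reprK -[v]reprK -[w]reprK.
rewrite -pi_scaleE -raddfD !L2_dot_pi.
rewrite -cintZ; last exact: sqfun_mulJ.
rewrite -cintD; [|exact/cintegrableZ/sqfun_mulJ|exact: sqfun_mulJ].
by congr cint; apply/funext => x /=; rewrite mulrDl mulrA.
Qed.

Lemma L2_dotr u : linear_for (Num.conj \; *%R) (L2_dot u).
Proof.
move=> a v w; rewrite /= ![L2_dot u _]L2_dotC !expr0 !mul1r.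
by rewrite L2_dotl rmorphD rmorphM.
Qed.

HB.instance Definition _ := bilinear_isBilinear.Build C L2 L2 C _ _ L2_dot
  (L2_dotl, L2_dotr).
HB.instance Definition _ := isHermitianSesquilinear.Build C L2 false Num.conj
  L2_dot L2_dotC.

Lemma L2_dot_gt0 (u : L2) : u != 0 -> 0 < L2_dot u u.
Proof.
rewrite -[u]reprK; set f := repr u => u0.
have [mf fi] := sqintP _ (valP f).
rewrite L2_dot_pi (_ : cint _ = (\int[mu]_(x in @Omega R) sqmod (f x))%:C); last first.
  rewrite /cint; congr (_ +i* _).
    by apply: eq_Rintegral => x _; case: (f x) => a b; rewrite /sqmod/=; ring.
  rewrite (@eq_Rintegral _ _ _ _ _ (cst 0)); first by rewrite /Rintegral integral0.
  by move=> x _; case: (f x) => a b /=; ring.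
rewrite ltcR lt_neqAle Rintegral_ge0 ?andbT//; last by move=> *; exact: sqmod_ge0.
apply: contra_neq u0 => /esym i0.
rewrite -[RHS](raddf0 (\pi_L2 : sqfun -> L2)).
apply: (iffRL (L2_eqP f 0)).
have : (\int[mu]_(x in @Omega R) `|(sqmod (f x))%:E| = 0)%E.
  transitivity (\int[mu]_(x in @Omega R) (sqmod (f x))%:E)%E.
    by apply: eq_integral => x _; rewrite gee0_abs// lee_fin sqmod_ge0.
  rewrite -[LHS]fineK; last exact: (integrable_fin_num (@measurable_Omega R) fi).
  by move: i0; rewrite /Rintegral => ->.
move=> /ae_eq_integral_abs h.
have := h (@measurable_Omega R) (cmeasurable_sqmod mf).
apply: filterS => x + Ox; move=> /(_ Ox) [].
rewrite /sqmod; case: (f x) => a b /=.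
move=> /eqP; rewrite paddr_eq0 ?sqr_ge0// !sqrf_eq0 => /andP[/eqP-> /eqP->].
by [].
Qed.

HB.instance Definition _ := isDotProduct.Build C L2 L2_dot L2_dot_gt0.

HB.instance Definition _ := Lmodule_isNormed.Build C L2
  (ler_dot_normD L2_dot) (dot_normZ L2_dot) (dot_norm0_eq0 (dot := L2_dot)).

End L2space.

Section G0.
Variable R : realType.
Local Notation C := R[i].
Local Notation T := (measurableTypeR R).
Local Notation mu := (@lebesgue_measure R).
Local Notation L2 := (L2 R).

Lemma Omega1 : mu (@Omega R) = 1%E.
Proof. by rewrite /Omega lebesgue_measure_itv/= lte01 oppr0 adde0. Qed.

Lemma sqint1 : (cst 1 : T -> C) \in @sqint R.
Proof.
apply/sqintP; split; first exact: cmeasurable_cst.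
apply: (eq_integrable (@measurable_Omega R) (cst 1%E)).
  by move=> x _ /=; rewrite /sqmod/= expr0n expr1n addr0.
apply/integrableP; split; first exact: measurable_cst.
under eq_integral do rewrite /= normr1.
rewrite integral_cst//; last exact: measurable_Omega.
rewrite [X in (_ * X)%E](_ : _ = mu (@Omega R))// Omega1 mule1.
exact: ltry.
Qed.

Definition L2_one : L2 := \pi_L2 (SqFun sqint1).

Lemma L2_dot11 : L2_dot L2_one L2_one = 1.
Proof.
rewrite L2_dot_pi (_ : (fun x : T => _) = cst 1); last first.
  apply/funext => x; change ((1 : C) * (1 : C)^*%C = 1); by rewrite conjc1 mulr1.
rewrite /cint /= Rintegral_cst//; last exact: measurable_Omega.
rewrite [X in fine X](_ : _ = mu (@Omega R))// Omega1 mul1r.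
by rewrite /Rintegral integral0.
Qed.

Definition g0_pred : {pred L2} := [pred u | L2_dot u L2_one == 0].

Lemma g0_submod_closed : submod_closed g0_pred.
Proof.
split=> [|a u v]; rewrite !inE; first by rewrite linear0l.
by move=> /eqP u0 /eqP v0; rewrite linearPl/= u0 v0 mulr0 addr0.
Qed.

HB.instance Definition _ := GRing.isSubmodClosed.Build C L2 g0_pred
  g0_submod_closed.

Record g0 := G0 { iota0 :> L2; _ : iota0 \in g0_pred }.
HB.instance Definition _ := [isSub for iota0].
HB.instance Definition _ := [Choice of g0 by <:].
HB.instance Definition _ := [SubChoice_isSubLmodule of g0 by <:].

Definition g0_dot (u v : g0) : C := L2_dot (iota0 u) (iota0 v).

Lemma g0_dotl v : linear_for *%R (g0_dot^~ v).
Proof. by move=> a u w; rewrite /g0_dot/= linearPl. Qed.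

Lemma g0_dotr u : linear_for (Num.conj \; *%R) (g0_dot u).
Proof. by move=> a v w; rewrite /g0_dot/= linearPr. Qed.

Lemma g0_dotC u v : g0_dot u v = (-1) ^+ false * Num.conj (g0_dot v u).
Proof. exact: hermC. Qed.

Lemma g0_dot_gt0 u : u != 0 -> 0 < g0_dot u u.
Proof. by move=> u0; rewrite /g0_dot dnorm_gt0. Qed.

HB.instance Definition _ := bilinear_isBilinear.Build C g0 g0 C _ _ g0_dot
  (g0_dotl, g0_dotr).
HB.instance Definition _ := isHermitianSesquilinear.Build C g0 false Num.conj
  g0_dot g0_dotC.
HB.instance Definition _ := isDotProduct.Build C g0 g0_dot g0_dot_gt0.
HB.instance Definition _ := Lmodule_isNormed.Build C g0
  (ler_dot_normD g0_dot) (dot_normZ g0_dot) (dot_norm0_eq0 (dot := g0_dot)).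

Lemma iota0_adj_subproof (u : L2) : u - L2_dot u L2_one *: L2_one \in g0_pred.
Proof.
by rewrite inE linearBl/= linearZl_LR/= L2_dot11 mulr1 subrr.
Qed.

Definition iota0_adj (u : L2) : g0 := G0 (iota0_adj_subproof u).

Lemma iota0_adjP (u : L2) (v : g0) :
  g0_dot (iota0_adj u) v = L2_dot u (iota0 v).
Proof.
rewrite /g0_dot/= linearBl/= linearZl_LR/= [L2_dot L2_one _]hermC.
by case: v => v /= /eqP ->; rewrite rmorph0 !mulr0 subr0.
Qed.

End G0.

Section LinearRelations.
Variables (R : realType) (H : normedModType R[i]).
Local Notation C := (R[i] : numFieldType).
Implicit Types (a : set (H * H)) (lam : C).

Definition rel_inv a : set (H * H) := [set p | a (p.2, p.1)].

Definition rel_shift a lam : set (H * H) :=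
  [set (q.1, q.2 - lam *: q.1) | q in a].

Definition bounded_operator a : Prop :=
  exists2 f : {linear H -> H}, continuous f & a = [set p | p.2 = f p.1].

Definition resolvent_set a : set C :=
  [set lam | bounded_operator (rel_inv (rel_shift a lam))].

(* (a - lam)^-1 phi; meaningful when lam is in the resolvent set of a *)
Definition resolvent a lam (phi : H) : H :=
  get [set psi | rel_inv (rel_shift a lam) (phi, psi)].

End LinearRelations.

Definition holomorphic_on (R : realType) (H : normedModType R[i])
    (D : set (R[i] : numFieldType)) (f : (R[i] : numFieldType) -> H) : Prop :=
  forall z, D z -> derivable (f : (R[i] : numFieldType)^o -> H) z 1.

(* The form dot is linear in its first argument, so <psi, phi> in the convention
   of an inner product linear in its second argument is dot phi psi. *)
Section HolomorphicGConvergence.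
Variables (R : realType) (H : normedModType R[i]).
Local Notation C := (R[i] : numFieldType).
Variable dot : H -> H -> C.
Implicit Types (omega : set C) (a : nat -> set (H * H)) (phi : H).

Definition resolvent_bounded omega a : Prop :=
  forall K : set C, compact K -> K `<=` omega ->
  exists M : R, forall n lam phi, K lam ->
    `|resolvent (a n) lam phi| <= M%:C * `|phi|.

Definition weak_resolvent_limit omega a phi (f : C -> H) : Prop :=
  holomorphic_on omega f /\
  forall psi (K : set C), compact K -> K `<=` omega ->
    {uniform K, (fun n lam => dot (resolvent (a n) lam phi) psi) @ \oo -->
                (fun lam => dot (f lam) psi)}.

Definition holomorphic_ext0 omega (f : C -> H) (v : H) : Prop :=
  exists (U : set C) (g : C -> H),
    [/\ open U, U 0, holomorphic_on (omega `|` U) g,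
        forall lam, omega lam -> g lam = f lam & g 0 = v].

(* The graph of phi |-> f_phi(0), whose domain is the set G of the definition. *)
Definition G_graph omega a : set (H * H) :=
  [set p | exists2 f, weak_resolvent_limit omega a p.1 f &
                      holomorphic_ext0 omega f p.2].

Definition hol_Gcvg omega a (b : set (H * H)) : Prop :=
  [/\ forall n, bounded_operator (a n),
      [/\ open omega, forall n, omega `<=` resolvent_set (a n) & closure omega 0],
      resolvent_bounded omega a,
      dense [set phi | exists psi, G_graph omega a (phi, psi)] &
      rel_inv b = G_graph omega a].

End HolomorphicGConvergence.

Section Coefficients.
Variable R : realType.
Local Notation C := (R[i] : numFieldType).
Local Notation T := (measurableTypeR R).
Local Notation mu := (@lebesgue_measure R).

Definition Linf_Omega (beta : T -> C) : Prop :=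
  cmeasurable beta /\
  exists M : R, \forall x \ae mu, Omega x -> `|beta x| <= M%:C.

(* The operator of multiplication by beta, as a graph. *)
Definition mul_op (beta : T -> C) : set (L2 R * L2 R) :=
  [set p | \forall x \ae mu, Omega x -> L2_fun p.2 x = beta x * L2_fun p.1 x].

Definition compress (a : set (L2 R * L2 R)) : set (g0 R * g0 R) :=
  [set p | exists2 q, a (iota0 p.1, q) & p.2 = iota0_adj q].

Definition hol_Gcvg_coef (omega : set C) (beta : nat -> T -> C)
    (b : set (L2 R * L2 R)) : Prop :=
  (forall n, Linf_Omega (beta n)) /\
  exists2 a, hol_Gcvg (@g0_dot R) omega (fun n => compress (mul_op (beta n))) a &
             rel_inv a = rel_inv (compress b).

Definition inner_spectrum (a : set (L2 R * L2 R)) : set C :=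
  ~` resolvent_set (compress a).

Definition slit_domain (r : R) : set C :=
  [set z | complex.Im z != 0 \/ r < complex.Re z].

End Coefficients.

(* Main.v *)
(* Write a_n for the compression of multiplication by alpha_n to
   g_0 and m(lam) for the mean of 1 / (alpha - lam). Up to a multiple of
   1 / (alpha_n - lam), which restores the mean-zero constraint, the resolvent
   (a_n - lam)^-1 phi is phi / (alpha_n - lam). By periodicity the functions
   1 / (alpha_n - lam) converge weakly to the constant m(lam), uniformly for lam
   at a positive distance from the values of alpha; since phi has mean zero, the
   correction disappears in the limit, so that f_phi(lam) = m(lam) phi. As
   1 / alpha is bounded, m is holomorphic near 0, and m(0) is the mean of
   1 / alpha, that is 0. Hence f_phi(0) = 0 for every phi. *)

Require Import Defs.
From HB Require Import structures.
From mathcomp Require Import all_boot all_order all_algebra.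
From mathcomp Require Import complex.
From mathcomp Require Import all_classical all_reals all_analysis.
From mathcomp Require Import measurable_realfun ess_sup_inf.
From mathcomp Require Import ring lra.

Set Implicit Arguments.
Unset Strict Implicit.
Unset Printing Implicit Defensive.

Import Order.TTheory GRing.Theory Num.Theory.
Import numFieldNormedType.Exports.

Local Open Scope classical_set_scope.
Local Open Scope ring_scope.
Local Open Scope complex_scope.

(* Over the carrier [R] itself (as opposed to [measurableTypeR R]) the search
   for the filter structure of [\forall x \ae mu, _] fails, so that [filterS]
   needs these instances. *)
Section AlmostEverywhere.
Variable R : realType.
Local Notation mu := (@lebesgue_measure R).
Implicit Types P Q S : R -> Prop.

(** The point 0 cannot be reached through the operators themselves: [1 / alpha_n] has mean zero and
    [alpha_n] maps it to the constant 1, which the projection kills, so 0 is an eigenvalue of every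
    compression. Hence two distances occur. The distance of [lam] to the interval [[-N, N]] ([gap])
    gives coercivity, which survives compression and bounds the resolvents uniformly in [n]. The
    distance to the values of [alpha] alone ([far]) is still positive at 0 and is enough for the
    holomorphy of the mean. The correction term is not estimated through its explicit coefficient,
    which would call for a lower bound on the mean of [1 / (alpha_n - lam)]. With [P] the projection
    and [s] the mean of [phi / (alpha_n - lam)], the resolvent of [phi] is
    [P (phi / (alpha_n - lam))] plus [s] times the resolvent of [P alpha_n]; coercivity bounds the
    latter and [s] tends to 0. Local uniformity in [lam] comes from the order of quantifiers in the
    averaging estimate: its threshold depends on the test function and the tolerance only, and its
    error is linear in the bound of the periodic factor. *)

Lemma lebesgue_aeS P Q : (forall x, P x -> Q x) ->
  (\forall x \ae mu, P x) -> \forall x \ae mu, Q x.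
Proof. exact: (@filterS _ _ (ae_filter_ringOfSetsType mu)). Qed.

Lemma lebesgue_aeS2 P Q S : (forall x, P x -> Q x -> S x) ->
  (\forall x \ae mu, P x) -> (\forall x \ae mu, Q x) -> \forall x \ae mu, S x.
Proof. exact: (@filterS2 _ _ (ae_filter_ringOfSetsType mu)). Qed.

End AlmostEverywhere.

(** * Affine change of variables for Lebesgue measure *)

Section AffineChange.
Variable R : realType.
Local Notation T := (measurableTypeR R).
Local Notation mu := (@lebesgue_measure R).
Variables (a b : R) (a_gt0 : 0 < a).

Let phi (x : T) : T := a * x + b.

Lemma measurable_affine : measurable_fun [set: T] phi.
Proof. by apply: measurable_funD => //; exact: measurable_funM. Qed.
#[local] Hint Resolve measurable_affine : core.

Lemma preimage_affine_itv (s t : bool) (u v : R) :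
  phi @^-1` [set` Interval (BSide s u) (BSide t v)] =
  [set` Interval (BSide s ((u - b) / a)) (BSide t ((v - b) / a))].
Proof.
apply/seteqP; split=> x; rewrite /phi /= !in_itv/= => /andP[ux xv].
  by apply/andP; split; [move: ux; case: s => /=|move: xv; case: t => /=];
    rewrite ?ler_pdivrMr ?ltr_pdivrMr ?ler_pdivlMr ?ltr_pdivlMr// 1?mulrC; lra.
by apply/andP; split; [move: ux; case: s => /=|move: xv; case: t => /=];
  rewrite ?ler_pdivrMr ?ltr_pdivrMr ?ler_pdivlMr ?ltr_pdivlMr// 1?mulrC; lra.
Qed.

(** The right-hand side is itself a measure in [A] (a scaled pushforward) and agrees with [mu] on
    half-open intervals, so uniqueness of Lebesgue measure applies. *)
Lemma lebesgue_affine (A : set T) : measurable A ->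
  mu A = (a%:E * mu (phi @^-1` A))%E.
Proof.
move=> mA; pose k := NngNum (ltW a_gt0).
have [m mE] : exists m : {measure set T -> \bar R},
    forall B, m B = (a%:E * mu (phi @^-1` B))%E.
  by unshelve eexists (mscale k (pushforward mu phi)).
rewrite -mE; apply: lebesgue_measure_unique mA => // _ [[u v] _ <-].
rewrite mE preimage_affine_itv !lebesgue_measure_itv/= !lte_fin.
rewrite ltr_pM2r ?invr_gt0// ltrD2r; case: ifPn; rewrite ?mule0// => _.
rewrite -!EFinD -EFinM; congr EFin; field; exact: lt0r_neq0.
Qed.

Lemma ge0_integral_affine (D : set T) (f : T -> \bar R) : measurable D ->
  measurable_fun D f -> (forall x, D x -> 0 <= f x)%E ->
  (\int[mu]_(x in D) f x = a%:E * \int[mu]_(x in phi @^-1` D) f (phi x))%E.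
Proof.
move=> mD mf f0.
rewrite -(ge0_integral_pushforward measurable_affine)//; last by move=> x /set_mem/f0.
pose k := NngNum (ltW a_gt0).
rewrite -(ge0_integral_mscale (pushforward mu phi) mD k)//.
by apply: eq_measure_integral => A mA _; exact: lebesgue_affine.
Qed.

(** Null sets pull back to null sets because [a] is nonzero; this carries almost everywhere
    identities for the coefficient over to its rescalings. *)
Lemma ae_affine (P : T -> Prop) :
  (\forall x \ae mu, P x) -> \forall x \ae mu, P (phi x).
Proof.
move=> [A [mA A0 PA]]; exists (phi @^-1` A); split.
- by rewrite -[X in measurable X]setTI; exact: measurable_affine.
- have := lebesgue_affine mA; rewrite A0 => /esym/eqP.
  by rewrite mule_eq0 eqe gt_eqF//= => /eqP.
- by move=> x nP; exact: PA.
Qed.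

Lemma integral_affine (D : set T) (f : T -> \bar R) : measurable D ->
  mu.-integrable D f ->
  (\int[mu]_(x in D) f x = a%:E * \int[mu]_(x in phi @^-1` D) f (phi x))%E.
Proof.
move=> mD fi; have mf := measurable_int mu fi.
have fp := integrable_funepos mD fi; have fn := integrable_funeneg mD fi.
have P := ge0_integral_affine mD (measurable_funepos mf) (fun x _ => funepos_ge0 f x).
have N := ge0_integral_affine mD (measurable_funeneg mf) (fun x _ => funeneg_ge0 f x).
(* Factoring [a] out of a difference of extended reals needs one finite term. An infinite integral
   here would stay infinite after multiplication by [a > 0], against the integrability of [f]. *)
have : (\int[mu]_(x in phi @^-1` D) f^\- (phi x))%E \is a fin_num.
  have I0 : (0 <= \int[mu]_(x in phi @^-1` D) f^\- (phi x))%E.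
    by apply: integral_ge0 => x _; exact: funeneg_ge0.
  have := integrable_fin_num mD fn; rewrite N !ge0_fin_numE//; last first.
    by apply: mule_ge0 => //; rewrite lee_fin ltW.
  by apply: contraTT; rewrite -!leNgt !leye_eq => /eqP ->; rewrite gt0_muley ?lte_fin.
move=> Nfin; transitivity (a%:E * \int[mu]_(x in phi @^-1` D) (f^\+ (phi x)) -
    a%:E * \int[mu]_(x in phi @^-1` D) (f^\- (phi x)))%E.
  by rewrite -P -N; exact: integralE.
rewrite -muleBr//; last by rewrite fin_num_adde_defl// fin_numN.
rewrite [in RHS](integralE _ _ (f \o phi)).
congr (_ * (_ - _))%E; apply: eq_integral => x _.
  by rewrite [RHS](congr1 (@^~ x) (funepos_comp f phi)).
by rewrite [RHS](congr1 (@^~ x) (funeneg_comp f phi)).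
Qed.

Lemma Rintegral_affine (D : set T) (f : T -> R) : measurable D ->
  mu.-integrable D (EFin \o f) ->
  \int[mu]_(x in D) f x = a * \int[mu]_(x in phi @^-1` D) f (phi x).
Proof.
move=> mD fi; rewrite /Rintegral (integral_affine mD fi)/=.
have := integrable_fin_num mD fi; rewrite (integral_affine mD fi)/=.
set I := integral _ _ _ => aI; rewrite fineM//.
by move: aI; case: I => //; rewrite ?gt0_muley ?gt0_muleNy ?lte_fin.
Qed.
End AffineChange.

(** * Averaging of rapidly oscillating periodic functions of mean zero *)

Section Oscillation.
Variable R : realType.
Local Notation T := (measurableTypeR R).
Local Notation mu := (@lebesgue_measure R).

Lemma Rintegral_affine_itv (a b u v : R) (f : T -> R) : 0 < a ->
  mu.-integrable `[a * u + b, a * v + b[ (EFin \o f) ->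
  \int[mu]_(x in `[a * u + b, a * v + b[) f x =
    a * \int[mu]_(x in `[u, v[) f (a * x + b).
Proof.
move=> a0 fi; rewrite (Rintegral_affine b a0 _ fi)//; congr (_ * _).
have affineK t : (a * t + b - b) / a = t by field; rewrite gt_eqF.
by rewrite preimage_affine_itv// !affineK.
Qed.

Lemma bounded_integrable_itv (f : T -> R) (M u v : R) :
  measurable_fun [set: T] f -> (forall x, `|f x| <= M) ->
  mu.-integrable `[u, v[ (EFin \o f).
Proof.
move=> mf fM; apply: measurable_bounded_integrable => //.
- rewrite /= lebesgue_measure_itv/=; case: ifP; rewrite ?ltry// => _; rewrite -EFinD ltry.
- exact: measurable_funTS.
- by exists M; split=> [|x Mx y _ /=]; [exact: num_real|rewrite (le_trans (fM y))// ltW].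
Qed.

Section PeriodicMeanZero.
Variables (k : T -> R) (M : R).
Hypotheses (mk : measurable_fun [set: T] k) (kM : forall x, `|k x| <= M).
Hypotheses (k_periodic : \forall x \ae mu, k ((x : R) + 1) = k x).
Hypothesis k_mean0 : \int[mu]_(x in `[0, 1[) k x = 0.

Lemma periodic_mean0_cell (j : nat) :
  \int[mu]_(x in `[j%:R, j.+1%:R[) k x = 0.
Proof.
elim: j => // j IHj; rewrite -[j.+1%:R in X in [set` X]]natr1 -[j.+2%:R]natr1.
rewrite -[j%:R]mul1r -[j.+1%:R]mul1r Rintegral_affine_itv//; last first.
  exact: bounded_integrable_itv.
rewrite mul1r -[RHS]IHj /Rintegral; congr fine; apply: ae_eq_integral => //.
- apply/measurable_EFinP/measurable_funTS/measurableT_comp => //.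
  by apply: measurable_funD => //; exact: measurable_funM.
- exact/measurable_EFinP/measurable_funTS.
- by apply: lebesgue_aeS k_periodic => x kx _; rewrite mul1r kx.
Qed.

Lemma periodic_mean0_scaled_cell (n j : nat) :
  \int[mu]_(x in `[j%:R / n.+1%:R, j.+1%:R / n.+1%:R[) k (n.+1%:R * x) = 0.
Proof.
have n0 : (0 : R) < n.+1%:R by [].
have nn (i : nat) : (i%:R : R) = n.+1%:R * (i%:R / n.+1%:R) + 0.
  by rewrite addr0 mulrC divfK// pnatr_eq0.
have I0 := periodic_mean0_cell j; rewrite [j%:R]nn [j.+1%:R]nn in I0.
move: I0; rewrite Rintegral_affine_itv//; last exact: bounded_integrable_itv.
move=> /eqP; rewrite mulf_eq0 pnatr_eq0/= => /eqP I0.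
by rewrite -[RHS]I0; apply: eq_Rintegral => x _; rewrite addr0.
Qed.

Lemma measurable_scaled (n : nat) : measurable_fun [set: T] (fun x : T => k (n.+1%:R * x)).
Proof. by apply: measurableT_comp => //; exact: measurable_funM. Qed.

Lemma integrable_mul_periodic (D : set T) (h : T -> R) (n : nat) : measurable D ->
  mu.-integrable D (EFin \o h) ->
  mu.-integrable D (EFin \o (fun x => h x * k (n.+1%:R * x))).
Proof.
move=> mD hi; have M0 : 0 <= M by exact: le_trans (kM 0).
have mh : measurable_fun D h by apply/measurable_EFinP; exact: (measurable_int mu hi).
have := integrableZl mD M hi; apply: le_integrable => //.
  apply/measurable_EFinP/measurable_funM => //.
  by apply: measurable_funTS; exact: measurable_scaled.
move=> x _; rewrite /= lee_fin !normrM mulrC (ger0_norm M0).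
by rewrite ler_wpM2r.
Qed.

(** On each of the [n.+1] cells of length [1 / n.+1] the oscillating factor has integral zero, so
    [g] may be replaced by its difference from its value at the left endpoint, which is at most [e].
    A cell thus contributes at most [M * e / n.+1], and the induction adds the cells up. *)
Lemma continuous_oscillation (g : R -> R) (n : nat) (e : R) : continuous g ->
  (forall x y : R, 0 <= x -> x <= y -> y <= x + n.+1%:R^-1 -> y <= 1 ->
     `|g x - g y| <= e) ->
  `|\int[mu]_(x in `[0, 1[) (g x * k (n.+1%:R * x))| <= M * e.
Proof.
move=> cg ge; pose N : R := n.+1%:R; have N0 : 0 < N by [].
have M0 : 0 <= M by exact: le_trans (kM 0).
have gi u v : mu.-integrable `[u, v[ (EFin \o g).
  apply: (@integrableS _ _ _ mu `[u, v]) => //; first exact: subset_itv_co_cc.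
  apply: continuous_compact_integrable; first exact: segment_compact.
  exact: continuous_subspaceT.
pose kn (x : T) := k (N * x).
have gki u v : mu.-integrable `[u, v[ (EFin \o (fun x => g x * kn x)).
  exact: integrable_mul_periodic.
suff : forall j, (j <= n.+1)%N ->
    `|\int[mu]_(x in `[0, j%:R / N[) (g x * kn x)| <= M * e * (j%:R / N).
  by move=> /(_ n.+1 (leqnn _)); rewrite divff ?mulr1// gt_eqF.
elim=> [_|j IHj jn]; first by rewrite mul0r set_itvco0 Rintegral_set0 normr0 mulr0.
pose c : R := j%:R / N; pose d : R := j.+1%:R / N.
have c0 : 0 <= c by rewrite divr_ge0// ltW.
have dE : d = c + N^-1 by rewrite /d /c -natr1 mulrDl mul1r.
have cd : c <= d by rewrite dE lerDl invr_ge0 ltW.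
have d1 : d <= 1 by rewrite ler_pdivrMr// mul1r ler_nat.
rewrite -/d (@itv_bndbnd_setU _ _ _ (BLeft c)) ?bnd_simp//.
rewrite Rintegral_setU//; last 2 first.
- rewrite -itv_bndbnd_setU ?bnd_simp//; exact: gki.
- apply/disj_setPS => x [/=]; rewrite !in_itv/= => /andP[_ xc] /andP[cx _].
  by move: xc; rewrite ltNge cx.
apply: le_trans (ler_normD _ _) _.
rewrite [d in leRHS]dE mulrDr lerD ?IHj 1?ltnW//.
have kni : mu.-integrable `[c, d[ (EFin \o kn).
  exact: (bounded_integrable_itv c d (measurable_scaled n) (fun x => kM (N * x))).
have gckni : mu.-integrable `[c, d[ (EFin \o (fun x => g c * kn x)).
  by have := integrableZl _ (g c) kni; apply.
have -> : \int[mu]_(x in `[c, d[) (g x * kn x) =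
    \int[mu]_(x in `[c, d[) (g x * kn x - g c * kn x).
  rewrite RintegralB//.
  by rewrite RintegralZl// (periodic_mean0_scaled_cell n j) mulr0 subr0.
have dki : mu.-integrable `[c, d[ (EFin \o (fun x => g x * kn x - g c * kn x)).
  by have := integrableB _ (gki c d) gckni; apply.
apply: le_trans (le_normr_Rintegral _ _) _ => //.
apply: (@le_trans _ _ (\int[mu]_(x in `[c, d[) (M * e))).
  apply: le_Rintegral => //.
  - by have := integrable_abse dki.
  - by apply: (@bounded_integrable_itv (cst (M * e)) `|M * e|) => //.
  move=> x; rewrite /= in_itv/= => /andP[cx xd].
  rewrite -mulrBl normrM mulrC ler_pM//; first exact: kM.
  rewrite distrC ge//; last by rewrite (le_trans (ltW xd)).
  by rewrite -dE ltW.
rewrite Rintegral_cst//=; rewrite lebesgue_measure_itv/= lte_fin dE ltrDl invr_gt0 N0.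
by rewrite /= addrC addKr.
Qed.
End PeriodicMeanZero.

Lemma uniform_continuity_segment (g : R -> R) (e : R) : continuous g -> 0 < e ->
  exists2 d : R, 0 < d & forall x y : R, 0 <= x <= 1 -> `|x - y| < d -> `|g x - g y| <= e.
Proof.
move=> cg e0; have := @segment_compact R 0 1; rewrite compact_near_coveringP.
move=> /(_ R 0^'+ (fun d x : R => forall y : R, `|x - y| < d -> `|g x - g y| <= e)).
have H (x : R) : `[0, 1]%classic x -> \forall x' \near x & d \near 0^'+,
    forall y : R, `|x' - y| < d -> `|g x' - g y| <= e.
  move=> _; have e2 : 0 < e / 2 by rewrite divr_gt0.
  have /cvgrPdist_le/(_ _ e2)/nbhs_ballP[d /= d0 hd] := cg x.
  have d2 : 0 < d / 2 by rewrite divr_gt0.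
  exists (ball x (d / 2), [set t | t < d / 2]) => /=.
    split; first exact: nbhsx_ballx.
    exact: nbhs_right_lt.
  move=> [x' t] /= [xx' td] y x'y.
  have hx' : `|g x - g x'| <= e / 2 by apply: hd; apply: le_ball xx'; lra.
  have hy : `|g x - g y| <= e / 2.
    apply: hd; rewrite /ball/=; rewrite /ball/= in xx'.
    have := ler_distD x' x y; lra.
  by have := ler_distD (g x) (g x') (g y); rewrite (distrC (g x') (g x)); lra.
move=> /(_ (at_right_proper_filter _) H)[t /= t0 ht].
have t2 : 0 < t / 2 by rewrite divr_gt0.
(* [t] is only the radius of a right neighbourhood of 0 in which every tolerance is admissible;
   [t / 2] lies inside it. *)
exists (t / 2) => // x y x01; apply: ht => //=.
by rewrite sub0r normrN gtr0_norm//; lra.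
Qed.

(** [n0] is fixed before [k] and [M], so that a single threshold later serves all spectral
    parameters. An approximation of [h] in the integral norm by a continuous [g] costs [M * e / 2]
    whatever [k] is, and [continuous_oscillation] bounds the rest by the same amount. *)
Lemma periodic_mean0_averaging (h : T -> R) (e : R) :
  mu.-integrable (@Omega R) (EFin \o h) -> 0 < e ->
  exists n0 : nat, forall n (k : T -> R) (M : R), (n0 <= n)%N ->
    measurable_fun [set: T] k -> (forall x, `|k x| <= M) ->
    (\forall x \ae mu, k ((x : R) + 1) = k x) ->
    \int[mu]_(x in `[0, 1[) k x = 0 ->
    `|\int[mu]_(x in @Omega R) (h x * k (n.+1%:R * x))| <= M * e.
Proof.
move=> hi e0; have e2 : 0 < e / 2 by rewrite divr_gt0.
have Omega_fin : (mu (@Omega R) < +oo)%E by rewrite Omega1 ltry.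
have [g_ [cg gi]] := approximation_continuous_integrable (@measurable_Omega R) Omega_fin hi.
move=> /fine_fcvg/cvgrPdist_le/(_ _ e2)[m _ /(_ m (leqnn m))]/=.
set g := g_ m; rewrite sub0r normrN => hg.
have [d d0 gd] := uniform_continuity_segment (cg m) e2.
(* From this index on, the cell length [1 / n.+1] is below the modulus of continuity [d] of [g]. *)
exists (Num.truncn d^-1).+1 => n k M n0 mk kM kp k0.
have M0 : 0 <= M by exact: le_trans (kM 0).
pose kn (x : T) := k (n.+1%:R * x).
have mO := @measurable_Omega R.
have hki : mu.-integrable (@Omega R) (EFin \o (fun x => h x * kn x)).
  exact: integrable_mul_periodic.
have gki : mu.-integrable (@Omega R) (EFin \o (fun x => g x * kn x)).
  exact: (integrable_mul_periodic _ _ _ _ (gi m)).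
have hgi : mu.-integrable (@Omega R) (EFin \o (fun x => h x - g x)).
  by have := integrableB mO hi (gi m); apply.
have hgki : mu.-integrable (@Omega R) (EFin \o (fun x => (h x - g x) * kn x)).
  exact: (integrable_mul_periodic _ _ _ _ hgi).
have -> : \int[mu]_(x in @Omega R) (h x * kn x) =
    \int[mu]_(x in @Omega R) ((h x - g x) * kn x) +
    \int[mu]_(x in @Omega R) (g x * kn x).
  rewrite -RintegralD//; apply: eq_Rintegral => x _.
  by rewrite -mulrDl subrK.
have -> : M * e = M * (e / 2) + M * (e / 2) by field.
apply: le_trans (ler_normD _ _) _; apply: lerD; last first.
  rewrite (@Rintegral_itv_obnd_cbnd _ 0 (BLeft 1) (fun x => g x * kn x))//.
  apply: continuous_oscillation => //; first exact: cg.
  move=> x y x0 xy yx y1; apply: gd.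
    by rewrite x0 (le_trans xy).
  rewrite ler0_norm ?subr_le0// opprB.
  apply: (@le_lt_trans _ _ (n.+1%:R^-1)); first by rewrite lerBlDl.
  rewrite -[d]invrK ltf_pV2 ?posrE ?invr_gt0//.
  by rewrite (lt_le_trans (truncnS_gt _))// ler_nat ltnW.
apply: le_trans (le_normr_Rintegral _ _) _ => //.
have hga : mu.-integrable (@Omega R) (EFin \o (fun x => `|h x - g x|)).
  by have := integrable_abse hgi; apply.
apply: (@le_trans _ _ (\int[mu]_(x in @Omega R) (M * `|h x - g x|))).
  apply: le_Rintegral => //.
  - by have := integrable_abse hgki; apply.
  - by have := integrableZl mO M hga; apply.
  - by move=> x _; rewrite normrM mulrC ler_wpM2r//; exact: kM.
rewrite RintegralZl// ler_wpM2l//.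
by apply: le_trans hg; rewrite ler_norm.
Qed.

End Oscillation.
Local Open Scope quotient_scope.
Local Notation Re := complex.Re.
Local Notation Im := complex.Im.

(** * Complex modulus in terms of real and imaginary parts *)

Section Modulus.
Variable R : realType.
Local Notation C := R[i].
Implicit Types z w : C.

Lemma sqr_norm_sqmod z : `|z| ^+ 2 = (sqmod z)%:C.
Proof. by rewrite -add_Re2_Im2. Qed.

Lemma norm_leC_ge0 z (M : R) : `|z| <= M%:C -> 0 <= M.
Proof. by move=> zM; rewrite -ler0c (le_trans _ zM). Qed.

Lemma norm_le_sqmod z (M : R) : 0 <= M -> (`|z| <= M%:C) = (sqmod z <= M ^+ 2).
Proof.
move=> M0; rewrite -lecR -sqr_norm_sqmod rmorphXn/=.
by rewrite ler_pXn2r// nnegrE// ler0c.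
Qed.

Lemma norm_ge_sqmod z (M : R) : 0 <= M -> (M%:C <= `|z|) = (M ^+ 2 <= sqmod z).
Proof.
move=> M0; rewrite -[in RHS]lecR -sqr_norm_sqmod rmorphXn/=.
by rewrite ler_pXn2r// nnegrE// ler0c.
Qed.

Lemma normr_Re_le z (M : R) : `|z| <= M%:C -> `|Re z| <= M.
Proof. by move=> zM; rewrite -lecR (le_trans (normc_ge_Re z)). Qed.

Lemma normr_Im_le z (M : R) : `|z| <= M%:C -> `|Im z| <= M.
Proof.
move=> zM; have M0 := norm_leC_ge0 zM; move: zM; rewrite norm_le_sqmod// => zM.
rewrite -(ler_pXn2r (ltn0Sn 1)) ?nnegrE// real_normK ?num_real//.
by apply: le_trans zM; rewrite lerDr sqr_ge0.
Qed.

Lemma norm_le_ReIm z (A B : R) : `|Re z| <= A -> `|Im z| <= B -> `|z| <= (A + B)%:C.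
Proof.
move=> zA zB; have A0 : 0 <= A by exact: le_trans zA.
have B0 : 0 <= B by exact: le_trans zB.
rewrite norm_le_sqmod ?addr_ge0//.
have : Re z ^+ 2 <= A ^+ 2.
  by rewrite -real_normK ?num_real// lerXn2r ?nnegrE.
have : Im z ^+ 2 <= B ^+ 2.
  by rewrite -real_normK ?num_real// lerXn2r ?nnegrE.
have := mulr_ge0 A0 B0; rewrite /sqmod; lra.
Qed.

Lemma ReM z w : Re (z * w) = Re z * Re w - Im z * Im w.
Proof. by case: z w => [? ?] [? ?]. Qed.

Lemma ImM z w : Im (z * w) = Re z * Im w + Im z * Re w.
Proof. by case: z w => [? ?] [? ?]. Qed.

Lemma ReV z : Re z^-1 = Re z / sqmod z.
Proof. by case: z => a b. Qed.

Lemma ImV z : Im z^-1 = - (Im z / sqmod z).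
Proof. by case: z => a b. Qed.

Lemma sqmodM z w : sqmod (z * w) = sqmod z * sqmod w.
Proof. by case: z w => [? ?] [? ?]; rewrite /sqmod/=; ring. Qed.

Lemma mulJ_sqmod z : z * z^*%C = (sqmod z)%:C.
Proof. by rewrite -sqr_norm_sqmod sqr_normc. Qed.

End Modulus.

(** * Multiplication operators on [L2] *)

Section Multipliers.
Variable R : realType.
Local Notation C := R[i].
Local Notation T := (measurableTypeR R).
Local Notation mu := (@lebesgue_measure R).
Local Notation L2 := (L2 R).
Local Hint Resolve measurable_Omega : core.

Lemma sqint_mul (b f : T -> C) (M : R) : cmeasurable b ->
  (forall x, `|b x| <= M%:C) -> f \in @sqint R -> b \* f \in @sqint R.
Proof.
move=> mb bM /sqintP[mf fi]; apply/sqintP.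
have mbf := cmeasurableM mb mf; split=> //.
have := integrableZl' (M ^+ 2) fi.
apply: le_integrable => //; first exact: cmeasurable_sqmod.
move=> x _; have M0 := norm_leC_ge0 (bM x).
rewrite /= lee_fin !ger0_norm ?mulr_ge0 ?sqr_ge0 ?sqmod_ge0// sqmodM.
by rewrite ler_wpM2r ?sqmod_ge0// -norm_le_sqmod.
Qed.

(** The bound holds at every point and is carried as a real number, which keeps null sets out of the
    norm estimates. A coefficient known only almost everywhere enters through [mul_opE]. *)
Record multiplier := Multiplier {
  multiplier_val :> T -> C;
  multiplier_bound : R;
  multiplier_cmeasurable : cmeasurable multiplier_val;
  multiplier_le : forall x, `|multiplier_val x| <= multiplier_bound%:C }.

Definition mulL2 (b : multiplier) (u : L2) : L2 :=
  \pi_L2 (SqFun (sqint_mul (multiplier_cmeasurable b) (@multiplier_le b) (valP (repr u)))).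

Lemma L2_ext (u v : L2) :
  (\forall x \ae mu, Omega x -> repr u x = repr v x) -> u = v.
Proof. by move=> /(iffRL (L2_eqP _ _)); rewrite !reprK. Qed.

Lemma repr_mulL2 b u :
  \forall x \ae mu, Omega x -> repr (mulL2 b u) x = b x * repr u x.
Proof. exact: repr_piE. Qed.

Lemma repr_addL2 (u v : L2) :
  \forall x \ae mu, Omega x -> repr (u + v) x = repr u x + repr v x.
Proof.
apply: (iffLR (L2_eqP (repr (u + v)) (repr u + repr v))).
by rewrite reprK [RHS](raddfD (\pi_L2 : sqfun R -> L2)) /= !reprK.
Qed.

Lemma repr_scaleL2 a (u : L2) :
  \forall x \ae mu, Omega x -> repr (a *: u) x = a * repr u x.
Proof. exact: repr_piE. Qed.

Lemma mulL2_linear b : linear (mulL2 b).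
Proof.
move=> a u v; apply: L2_ext.
apply: filter_app (repr_mulL2 b (a *: u + v)); apply: filter_app (repr_addL2 (a *: u) v).
apply: filter_app (repr_scaleL2 a u); apply: filter_app (repr_mulL2 b v).
apply: filter_app (repr_mulL2 b u); apply: filter_app (repr_scaleL2 a (mulL2 b u)).
apply: filterS (repr_addL2 (a *: mulL2 b u) (mulL2 b v)) => x.
move=> h1 h2 h3 h4 h5 h6 h7 Ox; rewrite h1// h2// h3// h4// h7// h6// h5//.
ring.
Qed.
HB.instance Definition _ b :=
  GRing.isLinear.Build C L2 L2 *:%R (mulL2 b) (@mulL2_linear b).

Lemma mul_opE (b : T -> C) (c : multiplier) :
  (\forall x \ae mu, Omega x -> b x = c x) ->
  mul_op b = [set p | p.2 = mulL2 c p.1].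
Proof.
move=> bc; apply/seteqP; split=> [[u v]/= h|[u v]/= ->].
  apply: L2_ext; apply: filter_app (repr_mulL2 c u); apply: filter_app bc.
  by apply: filterS h => x h bc cu Ox; rewrite cu// -bc// -h.
rewrite /mul_op/=; apply: filter_app (repr_mulL2 c u).
by apply: filterS bc => x bc cu Ox; rewrite bc// -cu.
Qed.

Lemma mulL2_resolvent (b c : multiplier) (lam : C) (u : L2) :
  (forall x, (b x - lam) * c x = 1) ->
  mulL2 b (mulL2 c u) - lam *: mulL2 c u = u.
Proof.
move=> bc; apply/eqP; rewrite subr_eq; apply/eqP; apply: L2_ext.
apply: filter_app (repr_mulL2 b (mulL2 c u)); apply: filter_app (repr_mulL2 c u).
apply: filter_app (repr_scaleL2 lam (mulL2 c u)).
apply: filterS (repr_addL2 u (lam *: mulL2 c u)) => x h1 h2 h3 h4 Ox.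
rewrite h4// h1// h2// h3// -[X in _ = X + _]mul1r -(bc x); ring.
Qed.

Lemma dot_mulL2 b u v :
  L2_dot (mulL2 b u) v = cint (fun x => b x * (repr u x * (repr v x)^*%C)).
Proof.
rewrite -{1}[v]reprK L2_dot_pi; congr cint; apply/funext => x.
by rewrite mulrA.
Qed.

Lemma norm_dotL2 (u : L2) : `|u| ^+ 2 = L2_dot u u.
Proof. exact: sqrtCK. Qed.

Definition sqnorm (u : L2) : R := \int[mu]_(x in @Omega R) sqmod (repr u x).

Lemma cint_real (r : T -> R) : cint (fun x => (r x)%:C) = (\int[mu]_(x in @Omega R) r x)%:C.
Proof.
by rewrite /cint /=; congr (_ +i* _); rewrite /Rintegral integral0.
Qed.

Lemma L2_dotuu (u : L2) : L2_dot u u = (sqnorm u)%:C.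
Proof.
rewrite -cint_real; congr cint; apply/funext => x; exact: mulJ_sqmod.
Qed.

Lemma dot_mulL2_real (b : multiplier) (r : T -> R) u : (forall x, b x = (r x)%:C) ->
  L2_dot (mulL2 b u) u = (\int[mu]_(x in @Omega R) (r x * sqmod (repr u x)))%:C.
Proof.
move=> br; rewrite -cint_real dot_mulL2; congr cint; apply/funext => x.
by rewrite br mulJ_sqmod rmorphM.
Qed.

Lemma sqmod_integrable (u : L2) :
  mu.-integrable (@Omega R) (EFin \o (fun x => sqmod (repr u x))).
Proof. by have /sqintP[] := valP (repr u). Qed.

(** This locates the numerical range of a real multiplier in [[-N, N]], the source of coercivity for
    [lam] off that interval. *)
Lemma norm_dot_mulL2_real (b : multiplier) (r : T -> R) (N : R) u :
  (forall x, b x = (r x)%:C) -> (forall x, `|r x| <= N) ->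
  exists2 t : R, L2_dot (mulL2 b u) u = t%:C & `|t| <= N * sqnorm u.
Proof.
move=> br rN; rewrite (dot_mulL2_real _ br); eexists; first reflexivity.
have ui := sqmod_integrable u.
have uN : mu.-integrable (@Omega R) (EFin \o (fun x => N * sqmod (repr u x))).
  exact: integrableZl' ui.
have ru x : `|r x * sqmod (repr u x)| <= N * sqmod (repr u x).
  by rewrite normrM (ger0_norm (sqmod_ge0 _)) ler_wpM2r// sqmod_ge0.
have rui : mu.-integrable (@Omega R) (EFin \o (fun x => r x * sqmod (repr u x))).
  apply: le_integrable uN => //.
    have [mb _] := multiplier_cmeasurable b.
    apply/measurable_EFinP/measurable_funM.
      by apply: eq_measurable_fun mb => x _; rewrite /= br.
    by apply/measurable_EFinP; apply: (measurable_int mu ui).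
  move=> x _; rewrite /= lee_fin (le_trans (ru x))// ler_norm//.
apply: le_trans (le_normr_Rintegral _ _) _ => //.
rewrite -RintegralZl//; apply: le_Rintegral => //.
by have := integrable_abse rui; apply.
Qed.

Lemma norm_mulL2 (b : multiplier) u : `|mulL2 b u| <= (multiplier_bound b)%:C * `|u|.
Proof.
have M0 := norm_leC_ge0 (multiplier_le b point).
rewrite -(ler_pXn2r (ltn0Sn 1)) ?nnegrE ?mulr_ge0 ?ler0c// exprMn !norm_dotL2.
rewrite !L2_dotuu -rmorphXn -rmorphM/= lecR /sqnorm.
rewrite -RintegralZl//; last exact: sqmod_integrable.
have -> : \int[mu]_(x in @Omega R) sqmod (repr (mulL2 b u) x) =
    \int[mu]_(x in @Omega R) sqmod (b x * repr u x).
  rewrite /Rintegral; congr fine; apply: ae_eq_integral => //.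
  - exact: (measurable_int mu (sqmod_integrable _)).
  - apply: cmeasurable_sqmod; apply: cmeasurableM; first exact: multiplier_cmeasurable.
    exact: sqfun_cmeasurable.
  - by apply: filterS (repr_mulL2 b u) => x h Ox; rewrite h.
apply: le_Rintegral => //.
- have /sqintP[_] := sqint_mul (multiplier_cmeasurable b) (multiplier_le b) (valP (repr u)).
  by apply.
- exact: integrableZl' (sqmod_integrable u).
- by move=> x _; rewrite sqmodM ler_wpM2r ?sqmod_ge0// -norm_le_sqmod// multiplier_le.
Qed.

End Multipliers.

(** * Compression to the mean-zero functions and its resolvent *)

Section Compression.
Variable R : realType.
Local Notation C := (R[i] : numFieldType).
Local Notation T := (measurableTypeR R).
Local Notation mu := (@lebesgue_measure R).
Local Notation L2 := (L2 R).
Local Notation g0 := (g0 R).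
Local Notation one := (L2_one R).

Lemma iota0_adj_linear : linear (@iota0_adj R).
Proof.
move=> a u v; apply: val_inj => /=.
rewrite linearPl/= scalerDl scalerBr scalerA opprD !addrA; congr (_ - _).
by rewrite addrAC.
Qed.
HB.instance Definition _ :=
  GRing.isLinear.Build R[i] L2 g0 *:%R (@iota0_adj R) iota0_adj_linear.

Lemma iota0_linear : linear (@iota0 R).
Proof. by []. Qed.
HB.instance Definition _ :=
  GRing.isLinear.Build R[i] g0 L2 *:%R (@iota0 R) iota0_linear.

Lemma iota0_adjK (u : g0) : iota0_adj (iota0 u) = u.
Proof.
apply: val_inj => /=; case: u => u /= /eqP ->.
by rewrite scale0r subr0.
Qed.

Lemma iota0_adj_one : iota0_adj one = 0.
Proof. by apply: val_inj; rewrite /= L2_dot11 scale1r subrr. Qed.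

Lemma iota0_adjE (u : L2) : iota0 (iota0_adj u) = u - L2_dot u one *: one.
Proof. by []. Qed.

Lemma g0_dot1 (u : g0) : L2_dot (iota0 u) one = 0.
Proof. by case: u => u /= /eqP. Qed.

Lemma dot_CS_L2 (u v : L2) : `|L2_dot u v| <= `|u| * `|v|.
Proof.
rewrite -(ler_pXn2r (ltn0Sn 1)) ?nnegrE ?mulr_ge0// exprMn !norm_dotL2.
exact: (dot_CauchySchwarz (@L2_dot R)).
Qed.

Lemma norm_iota0 (u : g0) : `|iota0 u| = `|u|.
Proof. by []. Qed.

Lemma norm_iota0_adj (u : L2) : `|iota0_adj u| <= `|u|.
Proof.
have [->|v0] := eqVneq (iota0_adj u) 0; first by rewrite normr0.
rewrite -(ler_pM2r (_ : 0 < `|iota0_adj u|)) ?normr_gt0// -expr2.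
have vE : `|iota0_adj u| ^+ 2 = L2_dot u (iota0_adj u).
  by rewrite -iota0_adjP -norm_iota0 norm_dotL2.
rewrite -[leLHS]ger0_norm ?exprn_ge0// vE -norm_iota0.
exact: dot_CS_L2.
Qed.

Variable b : multiplier R.

Definition g0_mul (u : g0) : g0 := iota0_adj (mulL2 b (iota0 u)).

Lemma g0_mul_linear : linear g0_mul.
Proof. by move=> a u v; rewrite /g0_mul !linearP. Qed.
HB.instance Definition _ :=
  GRing.isLinear.Build R[i] g0 g0 *:%R g0_mul g0_mul_linear.

Lemma norm_g0_mul u : `|g0_mul u| <= (multiplier_bound b)%:C * `|u|.
Proof. exact: le_trans (norm_iota0_adj _) (norm_mulL2 _ _). Qed.

Lemma bounded_linear_op (f : {linear g0 -> g0}) (M : R) :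
  (forall u, `|f u| <= M%:C * `|u|) -> continuous f.
Proof.
move=> fM; apply: bounded_linear_continuous; apply/linear_boundedP.
exists M%:C; split=> //; first by rewrite complex_real.
move=> r Mr u; apply: le_trans (fM u) _.
by rewrite ler_wpM2r// ltW.
Qed.

Lemma compress_mul_op (beta : T -> C) :
  (\forall x \ae mu, Omega x -> beta x = b x) ->
  compress (mul_op beta) = [set p | p.2 = g0_mul p.1].
Proof.
move=> betab; rewrite (mul_opE betab); apply/seteqP; split=> [[u v]/=|[u v]/= ->].
  by move=> [q /= -> ->].
by exists (mulL2 b (iota0 u)).
Qed.

Lemma bounded_operator_compress (beta : T -> C) :
  (\forall x \ae mu, Omega x -> beta x = b x) ->
  bounded_operator (compress (mul_op beta)).
Proof.
move=> /compress_mul_op ->; exists g0_mul => //.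
exact: bounded_linear_op norm_g0_mul.
Qed.

Section Resolvent.
Variables (c : multiplier R) (lam : R[i]) (d : R).
Hypothesis bc : forall x, (b x - lam) * c x = 1.
Hypothesis d_gt0 : 0 < d.
Hypothesis coercive : forall u : L2,
  d%:C * `|u| ^+ 2 <= `|L2_dot (mulL2 b u - lam *: u) u|.

Let A (u : g0) : g0 := g0_mul u - lam *: u.

Lemma g0_mul_shiftE u : A u = iota0_adj (mulL2 b u - lam *: iota0 u).
Proof. by rewrite /A [RHS]linearB/= [X in _ = _ - X]linearZ/= iota0_adjK. Qed.

(** Paired with an element [u] of [g0], the projection in [A u] disappears, so coercivity on [L2] is
    inherited. Invertibility of [b - lam] alone would not be. *)
Lemma g0_mul_bound u : d%:C * `|u| <= `|A u|.
Proof.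
have [->|u0] := eqVneq u 0; first by rewrite normr0 mulr0.
rewrite -(ler_pM2r (_ : 0 < `|u|)) ?normr_gt0// -mulrA -expr2.
apply: le_trans (coercive (iota0 u)) _.
have -> : L2_dot (mulL2 b u - lam *: iota0 u) (iota0 u) = L2_dot (iota0 (A u)) (iota0 u).
  by rewrite -iota0_adjP g0_mul_shiftE.
exact: dot_CS_L2.
Qed.

(** With [e = mulL2 c one], the form [<(b - lam) e, e>] is [<one, e>]. Were it zero, coercivity
    would give [e = 0] and hence [one = (b - lam) e = 0]. *)
Lemma dot_inv_neq0 : L2_dot (mulL2 c one) one != 0.
Proof.
apply/eqP => e0; have e1 := mulL2_resolvent one bc.
have : d%:C * `|mulL2 c one| ^+ 2 <= 0.
  apply: le_trans (coercive _) _.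
  by rewrite e1 [X in `|X|]hermC/= expr0 mul1r e0 rmorph0 normr0.
rewrite pmulr_rle0 ?ltcR// => e2.
have /eqP : `|mulL2 c one| ^+ 2 = 0 by apply: le_anti; rewrite e2 exprn_ge0.
rewrite sqrf_eq0 normr_eq0 => /eqP ce.
move: e1; rewrite ce linear0 scaler0 subrr => /esym one0.
by have := L2_dot11 R; rewrite one0 linear0l => /esym/eqP; rewrite oner_eq0.
Qed.

Lemma g0_mul_surj (phi : g0) : exists psi, A psi = phi.
Proof.
pose u := mulL2 c phi; pose e := mulL2 c one.
(* Under [b - lam] the term [t *: e] becomes [t *: one], which the projection annihilates, so [t] is
   free to be chosen for the mean. *)
pose t := L2_dot u one / L2_dot e one.
have psi0 : L2_dot (u - t *: e) one == 0.
  by rewrite linearBl/= linearZl_LR/= divfK ?subrr// dot_inv_neq0.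
exists (G0 psi0); rewrite g0_mul_shiftE [iota0 _]/=.
have -> : mulL2 b (u - t *: e) - lam *: (u - t *: e) = iota0 phi - t *: one.
  rewrite -[X in _ = X - _](mulL2_resolvent phi bc).
  rewrite -[X in _ = _ - _ *: X](mulL2_resolvent one bc).
  rewrite linearB linearZ/= -/u -/e !scalerBr !opprB !scalerA mulrC.
  by rewrite [X in _ + X = _]addrC addrACA [X in _ = _ + X]addrC.
by rewrite linearB linearZ/= iota0_adjK iota0_adj_one scaler0 subr0.
Qed.

Lemma g0_mul_shift_linear : linear A.
Proof.
move=> a u v; rewrite /A linearP scalerDr opprD scalerBr !scalerA [lam * a]mulrC.
by rewrite addrACA.
Qed.

Lemma g0_mul_shift_inj : injective A.
Proof.
move=> u v uv; apply/eqP; rewrite -subr_eq0 -normr_eq0; apply/eqP.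
have Auv : A (u - v) = 0.
  by rewrite -[u - v]addrC -scaleN1r g0_mul_shift_linear uv scaleN1r addNr.
apply: le_anti; rewrite normr_ge0 andbT -(pmulr_rle0 _ (_ : 0 < d%:C)) ?ltcR//.
by apply: le_trans (g0_mul_bound _) _; rewrite Auv normr0.
Qed.

Variables (beta : T -> C).
Hypothesis betab : \forall x \ae mu, Omega x -> beta x = b x.
Let a := compress (mul_op beta).

Lemma rel_inv_shift_compress : rel_inv (rel_shift a lam) = [set p | A p.2 = p.1].
Proof.
rewrite /a (compress_mul_op betab); apply/seteqP; split=> [[u v]|[u v]].
  by move=> [[q1 q2] /= ->] [<- <-].
by move=> /= <-; exists (v, g0_mul v).
Qed.

Lemma resolvent_compressP phi : A (resolvent a lam phi) = phi.
Proof.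
rewrite /resolvent rel_inv_shift_compress.
exact: (@getPex _ [set psi | A psi = phi] (g0_mul_surj phi)).
Qed.

Lemma norm_resolvent_compress phi : d%:C * `|resolvent a lam phi| <= `|phi|.
Proof. by rewrite -{2}[phi]resolvent_compressP g0_mul_bound. Qed.

Lemma resolvent_set_compress : resolvent_set a lam.
Proof.
(* [resolvent] selects preimages by choice; injectivity and linearity of [A] make the selection
   linear. *)
have lin : linear (resolvent a lam).
  move=> t u v; apply: g0_mul_shift_inj.
  by rewrite g0_mul_shift_linear !resolvent_compressP.
pose Rl : {linear g0 -> g0} :=
  HB.pack (resolvent a lam) (GRing.isLinear.Build R[i] g0 g0 *:%R (resolvent a lam) lin).
exists Rl.
  apply: (@bounded_linear_op _ d^-1) => u.
  rewrite -(ler_pM2l (_ : 0 < d%:C)) ?ltcR// mulrA -rmorphM divff ?gt_eqF// mul1r.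
  exact: norm_resolvent_compress.
rewrite rel_inv_shift_compress; apply/seteqP; split=> [[u v]/= <-|[u v]/= ->].
  by apply: g0_mul_shift_inj; rewrite resolvent_compressP.
exact: resolvent_compressP.
Qed.

(* The second term comes from the mean of [mulL2 c phi], which vanishes in the
   limit. *)
Lemma dot_resolvent_compress phi psi :
  g0_dot (resolvent a lam phi) psi =
  L2_dot (mulL2 c phi) psi + L2_dot (mulL2 c phi) one *
    g0_dot (resolvent a lam (iota0_adj (mulL2 b one))) psi.
Proof.
set s := L2_dot _ one; set r := resolvent a lam (iota0_adj _).
have -> : resolvent a lam phi = s *: r + iota0_adj (mulL2 c phi).
  (* The identity is checked after applying [A]: since [b c = 1 + lam c], the image of
     [iota0_adj (mulL2 c phi)] is [phi - s *: iota0_adj (mulL2 b one)], and [s *: r] supplies what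
     is missing. *)
  apply: g0_mul_shift_inj.
  rewrite resolvent_compressP g0_mul_shift_linear resolvent_compressP g0_mul_shiftE.
  rewrite -linearZ -linearD iota0_adjE /= linearB linearZ/= -/s.
  have -> : s *: mulL2 b one + (mulL2 b (mulL2 c phi) - s *: mulL2 b one -
      lam *: (mulL2 c phi - s *: one)) = iota0 phi + (lam * s) *: one.
    rewrite -[X in _ = X + _](mulL2_resolvent phi bc) scalerBr scalerA opprB.
    by rewrite !addrA addrAC [s *: _ + _]addrC addrK addrAC.
  by rewrite linearD linearZ/= iota0_adjK iota0_adj_one scaler0 addr0.
rewrite linearPl/= addrC; congr (_ + _).
by rewrite iota0_adjP.
Qed.
End Resolvent.
End Compression.

(** * Integrability and bounds for complex integrands *)

Section ComplexIntegrals.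
Variable R : realType.
Local Notation C := R[i].
Local Notation T := (measurableTypeR R).
Local Notation mu := (@lebesgue_measure R).
Local Hint Resolve measurable_Omega : core.

Lemma cintegrableD (f g : T -> C) : cintegrable f -> cintegrable g ->
  cintegrable (f \+ g).
Proof.
move=> [fR fI] [gR gI]; split.
  apply: (eq_integrable (@measurable_Omega R) (fun x => (Re (f x))%:E + (Re (g x))%:E)%E).
    by move=> x _ /=; case: (f x) (g x) => [? ?] [? ?].
  exact: integrableD.
apply: (eq_integrable (@measurable_Omega R) (fun x => (Im (f x))%:E + (Im (g x))%:E)%E).
  by move=> x _ /=; case: (f x) (g x) => [? ?] [? ?].
exact: integrableD.
Qed.

Lemma integrable_mul_bounded (f g : T -> R) (M : R) : measurable_fun (@Omega R) f ->
  (forall x, `|f x| <= M) -> mu.-integrable (@Omega R) (EFin \o g) ->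
  mu.-integrable (@Omega R) (EFin \o (fun x => f x * g x)).
Proof.
move=> mf fM gi; have := integrableZl' M gi.
apply: le_integrable => //.
  apply/measurable_EFinP/measurable_funM => //.
  by apply/measurable_EFinP; exact: (measurable_int mu gi).
move=> x _; rewrite /= lee_fin !normrM ler_wpM2r//.
by rewrite (le_trans (fM x))// ler_norm.
Qed.

Lemma cintegrable_mul (b : multiplier R) (h : T -> C) :
  cintegrable h -> cintegrable (fun x => b x * h x).
Proof.
move=> [hR hI]; have [mR mI] := multiplier_cmeasurable b.
have key f g := @integrable_mul_bounded f g (multiplier_bound b).
have bR x := normr_Re_le (multiplier_le b x).
have bI x := normr_Im_le (multiplier_le b x).
split.
  apply: (eq_integrable (@measurable_Omega R)
    (fun x => (Re (b x) * Re (h x))%:E - (Im (b x) * Im (h x))%:E)%E).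
    by move=> x _; rewrite /= ReM EFinB.
  by apply: integrableB => //; exact: key.
apply: (eq_integrable (@measurable_Omega R)
    (fun x => (Re (b x) * Im (h x))%:E + (Im (b x) * Re (h x))%:E)%E).
  by move=> x _; rewrite /= ImM EFinD.
by apply: integrableD => //; exact: key.
Qed.

Lemma bounded_Rintegral_le (f : T -> R) (M : R) : measurable_fun (@Omega R) f ->
  (forall x, `|f x| <= M) -> mu.-integrable (@Omega R) (EFin \o f) /\
  `|\int[mu]_(x in @Omega R) f x| <= M.
Proof.
move=> mf fM; have M0 : 0 <= M by exact: le_trans (fM point).
have Oy : (mu (@Omega R) < +oo)%E by rewrite Omega1 ltry.
have fi : mu.-integrable (@Omega R) (EFin \o f).
  apply: measurable_bounded_integrable => //.
  by exists M; split=> [|x Mx y _ /=]; [exact: num_real|rewrite (le_trans (fM y))// ltW].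
split=> //; apply: le_trans (le_normr_Rintegral _ _) _ => //.
have -> : M = \int[mu]_(x in @Omega R) M.
  by rewrite Rintegral_cst// [X in fine X](_ : _ = mu (@Omega R))// Omega1 mulr1.
apply: le_Rintegral => //.
- by have := integrable_abse fi; apply.
- apply: measurable_bounded_integrable => //.
  by exists M; split=> [|x Mx y _ /=]; [exact: num_real|rewrite ger0_norm// ltW].
Qed.

Lemma multiplier_cintegrable (b : multiplier R) : cintegrable b.
Proof.
have [mR mI] := multiplier_cmeasurable b.
split; first by have [] := bounded_Rintegral_le mR (fun x => normr_Re_le (multiplier_le b x)).
by have [] := bounded_Rintegral_le mI (fun x => normr_Im_le (multiplier_le b x)).
Qed.

(** The factor 2 is the price of bounding real and imaginary parts separately; it enters the
    constants [2 / d], [3 / d] and [4 / d ^+ 3] below. *)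
Lemma norm_cint_le (b : multiplier R) : `|cint b| <= (2 * multiplier_bound b)%:C.
Proof.
have [mR mI] := multiplier_cmeasurable b.
rewrite mulrDl !mul1r; apply: norm_le_ReIm.
  by have [] := bounded_Rintegral_le mR (fun x => normr_Re_le (multiplier_le b x)).
by have [] := bounded_Rintegral_le mI (fun x => normr_Im_le (multiplier_le b x)).
Qed.

Lemma mult_mul_le (b c : multiplier R) x :
  `|b x * c x| <= (multiplier_bound b * multiplier_bound c)%:C.
Proof. by rewrite normrM rmorphM/= ler_pM// multiplier_le. Qed.

Definition mult_mul (b c : multiplier R) : multiplier R :=
  Multiplier (cmeasurableM (multiplier_cmeasurable b) (multiplier_cmeasurable c))
    (mult_mul_le b c).

End ComplexIntegrals.

(** * Measurability of the real and imaginary parts of [1 / (t - lam)] *)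

Section InverseParts.
Variable R : realType.
Local Notation C := R[i].
Local Notation T := (measurableTypeR R).
Local Notation mu := (@lebesgue_measure R).
Local Hint Resolve measurable_Omega : core.

Lemma measurable_inv_sqmod (lam : C) :
  measurable_fun [set: R] (fun t : R => (sqmod (t%:C - lam))^-1).
Proof.
(* As the power -1 the inverse is measurable on the whole line, including a zero of the denominator
   when [lam] is real. *)
rewrite (_ : (fun t => _) = (@powR R)^~ (-1) \o (fun t : R => sqmod (t%:C - lam))); last first.
  by apply/funext => t; rewrite /= powR_inv1// sqmod_ge0.
apply: measurableT_comp; first exact: measurable_powR.
rewrite (_ : (fun t => _) = (fun t : R => (t - Re lam) ^+ 2 + Im lam ^+ 2)).
  apply: measurable_funD => //; apply: measurable_funX.
  exact: measurable_funB.
by apply/funext => t; case: lam => a b; rewrite /sqmod/= sub0r sqrrN.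
Qed.

Lemma measurable_Re_inv (lam : C) :
  measurable_fun [set: R] (fun t : R => Re (t%:C - lam)^-1).
Proof.
rewrite (_ : (fun t => _) = (fun t : R => (t - Re lam) * (sqmod (t%:C - lam))^-1)).
  apply: measurable_funM; last exact: measurable_inv_sqmod.
  exact: measurable_funB.
by apply/funext => t; rewrite ReV; case: lam => a b.
Qed.

Lemma measurable_Im_inv (lam : C) :
  measurable_fun [set: R] (fun t : R => Im (t%:C - lam)^-1).
Proof.
rewrite (_ : (fun t => _) = (fun t : R => Im lam * (sqmod (t%:C - lam))^-1)).
  apply: measurable_funM; last exact: measurable_inv_sqmod.
  exact: measurable_cst.
by apply/funext => t; rewrite ImV; case: lam => a b /=; rewrite sub0r mulNr opprK.
Qed.

End InverseParts.

(** * Weak limit of the resolvents for a coefficient bounded at every point *)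

Section HomogenizedResolvent.
Variable R : realType.
Local Notation C := R[i].
Local Notation T := (measurableTypeR R).
Local Notation mu := (@lebesgue_measure R).
Local Notation L2 := (L2 R).
Local Notation g0 := (g0 R).
Local Hint Resolve measurable_Omega : core.

Variables (r : T -> R) (N : R).
Hypotheses (mr : measurable_fun [set: T] r) (rN : forall x, `|r x| <= N).
Hypothesis r_periodic : \forall x \ae mu, r ((x : R) + 1) = r x.

Lemma measurable_comp_scaled (F : R -> R) (n : nat) : measurable_fun [set: R] F ->
  measurable_fun (@Omega R) (fun x : T => F (r (n.+1%:R * x))).
Proof.
move=> mF; apply: measurable_funTS; apply: measurableT_comp => //.
exact: measurable_scaled.
Qed.

Lemma scaled_cmeasurable n : cmeasurable (fun x : T => (r (n.+1%:R * x))%:C).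
Proof. by split=> /=; [exact: (@measurable_comp_scaled id)|exact: measurable_cst]. Qed.

Lemma norm_realc (t : R) : `|t%:C| = `|t|%:C.
Proof. by rewrite normc_def /= expr0n/= addr0 sqrtr_sqr. Qed.

Lemma scaled_le n (x : T) : `|(r (n.+1%:R * x))%:C| <= N%:C.
Proof. by rewrite norm_realc lecR. Qed.

Definition scaled_mult n : multiplier R := Multiplier (scaled_cmeasurable n) (scaled_le n).

Definition far (lam : C) (d : R) : Prop := 0 < d /\ forall x, d%:C <= `|(r x)%:C - lam|.

Definition inv_scaled n (lam : C) (x : T) : C := ((r (n.+1%:R * x))%:C - lam)^-1.

Lemma inv_scaled_cmeasurable n lam : cmeasurable (inv_scaled n lam).
Proof.
split.
  exact: (measurable_comp_scaled n (measurable_Re_inv lam)).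
exact: (measurable_comp_scaled n (measurable_Im_inv lam)).
Qed.

Lemma far_neq0 lam d x : far lam d -> (r x)%:C - lam != 0.
Proof. by move=> [d0 rd]; rewrite -normr_gt0 (lt_le_trans _ (rd x)) ?ltcR. Qed.

Lemma far_inv_le lam d x : far lam d -> `|((r x)%:C - lam)^-1| <= d^-1%:C.
Proof.
move=> H; have := far_neq0 x H; rewrite -normr_gt0 => p; case: H => d0 rd.
by rewrite normfV fmorphV/= lef_pV2// posrE ltcR.
Qed.

Definition inv_mult n lam d (H : far lam d) : multiplier R :=
  Multiplier (inv_scaled_cmeasurable n lam) (fun x => far_inv_le (n.+1%:R * x) H).

Lemma inv_multP n lam d (H : far lam d) x :
  (scaled_mult n x - lam) * inv_mult n H x = 1.
Proof. by rewrite mulfV// (far_neq0 _ H). Qed.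

(* The weak limit of [(alpha_n - lam)^-1]. *)
Definition mean_inv (lam : C) : C := cint (fun x : T => ((r x)%:C - lam)^-1).

(** Index 0 means the scaling factor 1, so the bounds on [inv_mult 0] apply to the mean. *)
Lemma mean_inv0E lam : mean_inv lam = cint (inv_scaled 0 lam).
Proof. by congr cint; apply/funext => x; rewrite /inv_scaled mul1r. Qed.

Lemma norm_mean_inv lam d : far lam d -> `|mean_inv lam| <= (2 / d)%:C.
Proof.
move=> H; rewrite mean_inv0E; exact: (norm_cint_le (inv_mult 0 H)).
Qed.

Lemma far_near lam d h : far lam d -> `|h| <= (d / 2)%:C -> far (lam + h) (d / 2).
Proof.
move=> [d0 rd] hd; split=> [|x]; first by rewrite divr_gt0.
have -> : (d / 2)%:C = d%:C - (d / 2)%:C :> C.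
  by rewrite -rmorphB; congr (_%:C); field.
rewrite opprD addrA (le_trans _ (lerB_dist _ _))// lerB//.
Qed.

(** With [y = r x - lam], this integrates the expansion [1/(y - h) = 1/y + h/y^2 + h^2/((y - h)
    y^2)]. The condition on [h] keeps [|y - h|] above [d / 2], so the remainder [p] is at most
    [2 / d^3], doubled by [norm_cint_le]. *)
Lemma mean_inv_quotient lam d (h : C) : far lam d -> h != 0 -> `|h| <= (d / 2)%:C ->
  `|h^-1 * (mean_inv (lam + h) - mean_inv lam) -
    cint (fun x : T => ((r x)%:C - lam)^-1 ^+ 2)| <= `|h| * (4 / d ^+ 3)%:C.
Proof.
move=> H h0 hd; have H' := far_near H hd.
pose j := inv_mult 0 H; pose j' := inv_mult 0 H'.
pose q := mult_mul j j; pose p := mult_mul j' q.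
have -> : cint (fun x : T => ((r x)%:C - lam)^-1 ^+ 2) = cint q.
  by congr cint; apply/funext => x; rewrite /= /inv_scaled mul1r.
have -> : mean_inv (lam + h) = mean_inv lam + h * (cint q + h * cint p).
  rewrite !mean_inv0E -[inv_scaled 0 lam]/(j : T -> C).
  have [cj cq cp] := And3 (multiplier_cintegrable j) (multiplier_cintegrable q)
    (multiplier_cintegrable p).
  have chp := cintegrableZ h cp; have cqp := cintegrableD cq chp.
  have chqp := cintegrableZ h cqp.
  rewrite -cintZ// -cintD// -cintZ -?cintD//.
  congr cint; apply/funext => x /=; rewrite /inv_scaled.
  have := far_neq0 (1 * x) H; have := far_neq0 (1 * x) H'.
  rewrite opprD addrA => y0 z0; field.
  by rewrite z0.
rewrite [mean_inv lam + _]addrC addrK mulKf// addrC addKr normrM ler_wpM2l//.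
apply: le_trans (norm_cint_le p) _; rewrite lecR /=.
by rewrite le_eqVlt; apply/orP; left; apply/eqP; field; exact: lt0r_neq0 H.1.
Qed.

Lemma mean_inv_derivable (phi : g0) lam d : far lam d ->
  derivable ((fun l => mean_inv l *: phi) : (C : numFieldType)^o -> g0) lam 1.
Proof.
move=> H; have d0 := H.1.
pose D := cint (fun x : T => ((r x)%:C - lam)^-1 ^+ 2).
apply/cvg_ex; exists (D *: phi).
apply/cvgrPdist_le => e e0.
have d2 : (0 : C) < (d / 2)%:C by rewrite ltcR divr_gt0.
(* The summand 1 keeps [K] positive when [phi = 0]. *)
pose K : C := (4 / d ^+ 3)%:C * `|phi| + 1.
have K0 : 0 < K.
  by rewrite ltr_wpDl// mulr_ge0// ler0c divr_ge0// exprn_ge0// ltW.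
have eK : 0 < e / K by rewrite divr_gt0.
near=> h.
have h0 : h != 0 by near: h; exact: nbhs_dnbhs_neq.
rewrite /= distrC [h *: 1]mulr1 -scalerBl scalerA -scalerBl normrZ.
rewrite [h + lam]addrC.
apply: le_trans (ler_wpM2r (normr_ge0 _) (mean_inv_quotient H h0 _)) _.
  by near: h; exact: dnbhs0_le.
have : `|h| <= e / K by near: h; exact: dnbhs0_le.
rewrite ler_pdivlMr// => hK; apply: le_trans hK.
rewrite -mulrA ler_wpM2l// /K lerDl//.
Unshelve. all: by end_near. Qed.

Lemma inv_scaled_integrable_itv lam d (F : C -> R) : far lam d ->
  (forall z (M : R), `|z| <= M%:C -> `|F z| <= M) ->
  measurable_fun [set: R] (fun t : R => F (t%:C - lam)^-1) ->
  mu.-integrable `[0, 1[ (EFin \o (fun x : T => F ((r x)%:C - lam)^-1)).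
Proof.
move=> H FM mF; apply: (@bounded_integrable_itv _ _ d^-1).
  exact: (measurableT_comp mF mr).
by move=> x; apply: FM; exact: far_inv_le.
Qed.

(** [F] is the real or the imaginary part, to which the real averaging estimate applies. Subtracting
    the mean gives the periodic factor mean zero, with bound [1 / d + 2 / d] independent of
    [lam]. *)
Lemma averaging_part (F : C -> R) (h : T -> R) (e : R) :
  (forall z w, F (z - w) = F z - F w) ->
  (forall z (M : R), `|z| <= M%:C -> `|F z| <= M) ->
  (forall lam, measurable_fun [set: R] (fun t : R => F (t%:C - lam)^-1)) ->
  (forall f : T -> C, F (cint f) = \int[mu]_(x in @Omega R) F (f x)) ->
  mu.-integrable (@Omega R) (EFin \o h) -> 0 < e ->
  exists n0 : nat, forall n lam d, (n0 <= n)%N -> far lam d ->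
    `|\int[mu]_(x in @Omega R) (h x * F (inv_scaled n lam x - mean_inv lam))|
      <= 3 / d * e.
Proof.
move=> FB FM mF Fint hi e0; have [n0 Hn0] := periodic_mean0_averaging hi e0.
exists n0 => n lam d nn0 H.
apply: (Hn0 n (fun x => F (((r x)%:C - lam)^-1 - mean_inv lam)) _ nn0).
- rewrite (_ : (fun x => _) = (fun x => F ((r x)%:C - lam)^-1 - F (mean_inv lam))).
    by apply: measurable_funB => //; exact: (measurableT_comp (mF lam) mr).
  by apply/funext => x; rewrite FB.
- move=> x; apply: FM; apply: le_trans (ler_normB _ _) _.
  have -> : (3 / d)%:C = d^-1%:C + (2 / d)%:C :> C.
    by rewrite -rmorphD; congr (_%:C); field; exact: lt0r_neq0 H.1.
  by apply: lerD; [exact: far_inv_le|exact: norm_mean_inv].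
- by apply: lebesgue_aeS r_periodic => x ->.
have i1 := inv_scaled_integrable_itv H FM (mF lam).
have i2 : mu.-integrable `[0, 1[ (EFin \o (fun _ : T => F (mean_inv lam))).
  by apply: (@bounded_integrable_itv _ _ `|F (mean_inv lam)|).
transitivity (\int[mu]_(x in `[0, 1[) (F ((r x)%:C - lam)^-1 - F (mean_inv lam))).
  by apply: eq_Rintegral => x _; rewrite FB.
rewrite RintegralB// Rintegral_cst//= lebesgue_measure_itv/= lte01 oppr0 adde0 mulr1.
rewrite -Rintegral_itv_obnd_cbnd; last first.
  by apply: integrableS i1 => //; apply: subset_itvr; rewrite bnd_simp.
by rewrite -[X in X - _]Fint subrr.
Qed.

Lemma averaging_L2 (u v : L2) (d e : R) : 0 < d -> 0 < e ->
  exists n0 : nat, forall n lam (H : far lam d), (n0 <= n)%N ->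
    `|L2_dot (mulL2 (inv_mult n H) u) v - mean_inv lam * L2_dot u v| <= e%:C.
Proof.
move=> d0 e0; pose h (x : T) := repr u x * (repr v x)^*%C.
have hi : cintegrable h by exact: sqfun_mulJ.
have [hR hI] := hi.
(* The product of two complex functions splits into four real integrals, each at most
   [3 / d * e' = e / 4]. *)
pose e' := e * d / 12; have e'0 : 0 < e' by rewrite !mulr_gt0.
have ReB : forall z w : C, Re (z - w) = Re z - Re w by move=> [? ?] [? ?].
have ImB : forall z w : C, Im (z - w) = Im z - Im w by move=> [? ?] [? ?].
have avR f fi := @averaging_part _ f _ ReB (@normr_Re_le R) (@measurable_Re_inv R)
  (fun=> erefl) fi e'0.
have avI f fi := @averaging_part _ f _ ImB (@normr_Im_le R) (@measurable_Im_inv R)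
  (fun=> erefl) fi e'0.
have [n1 H1] := avR _ hR.
have [n2 H2] := avI _ hI.
have [n3 H3] := avR _ hI.
have [n4 H4] := avI _ hR.
exists (maxn (maxn n1 n2) (maxn n3 n4)) => n lam H.
rewrite !geq_max => /andP[/andP[nn1 nn2] /andP[nn3 nn4]].
have bound : `|mean_inv lam| <= (2 / d)%:C by exact: norm_mean_inv.
have mi : cmeasurable (fun _ : T => mean_inv lam) by exact: cmeasurable_cst.
pose m : multiplier R := Multiplier mi (fun=> bound).
pose c := inv_mult n H.
have ch := cintegrable_mul c hi; have mh := cintegrable_mul m hi.
have -> : L2_dot (mulL2 c u) v - mean_inv lam * L2_dot u v =
    cint (fun x => (inv_scaled n lam x - mean_inv lam) * h x).
  rewrite dot_mulL2 -[L2_dot u v]/(cint h) -cintZ// -mulN1r -cintZ//.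
  rewrite -cintD//; last exact: cintegrableZ.
  by congr cint; apply/funext => x /=; rewrite mulN1r -mulrBl.
pose k (x : T) := inv_scaled n lam x - mean_inv lam.
have kb x : `|k x| <= (multiplier_bound c + 2 / d)%:C.
  rewrite rmorphD (le_trans (ler_normB _ _))// lerD//.
  exact: (multiplier_le c).
have mk : cmeasurable k.
  have := cmeasurableD (multiplier_cmeasurable c) (cmeasurable_cst (- mean_inv lam)).
  by apply.
have kR x := normr_Re_le (kb x); have kI x := normr_Im_le (kb x).
have [mkR mkI] := mk.
have eE : e%:C = (e / 2 + e / 2)%:C :> C by congr (_%:C); field.
have e4 : 3 / d * e' = e / 4 by rewrite /e'; field; exact: lt0r_neq0.
have split4 (x y : R) : `|x| <= e / 4 -> `|y| <= e / 4 ->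
    `|x - y| <= e / 2 /\ `|x + y| <= e / 2.
  rewrite !ler_norml => /andP[? ?] /andP[? ?].
  by split; apply/andP; split; lra.
have integrable_kh (f g : T -> R) : measurable_fun (@Omega R) f ->
    (forall x, `|f x| <= multiplier_bound c + 2 / d) ->
    mu.-integrable (@Omega R) (EFin \o g) ->
    mu.-integrable (@Omega R) (EFin \o (fun x => g x * f x)).
  move=> mf fM gi; have := integrable_mul_bounded mf fM gi.
  by apply: eq_integrable => // x _; rewrite /= mulrC.
rewrite eE; apply: norm_le_ReIm; rewrite /cint /=.
  have -> : \int[mu]_(x in @Omega R) Re (k x * h x) =
      \int[mu]_(x in @Omega R) (Re (h x) * Re (k x)) -
      \int[mu]_(x in @Omega R) (Im (h x) * Im (k x)).
    rewrite -RintegralB; [|exact: measurable_Omega|exact: integrable_kh|exact: integrable_kh].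
    by apply: eq_Rintegral => x _; rewrite ReM [Re _ * _]mulrC [Im _ * _]mulrC.
  apply: (split4 _ _ _ _).1; rewrite -e4; first exact: (H1 n lam d nn1 H).
  exact: (H2 n lam d nn2 H).
have -> : \int[mu]_(x in @Omega R) Im (k x * h x) =
    \int[mu]_(x in @Omega R) (Im (h x) * Re (k x)) +
    \int[mu]_(x in @Omega R) (Re (h x) * Im (k x)).
  rewrite -RintegralD; [|exact: measurable_Omega|exact: integrable_kh|exact: integrable_kh].
  by apply: eq_Rintegral => x _; rewrite ImM; congr (_ + _); exact: mulrC.
apply: (split4 _ _ _ _).2; rewrite -e4; first exact: (H3 n lam d nn3 H).
exact: (H4 n lam d nn4 H).
Qed.

Section Gap.
(* While [far] bounds the distance of [lam] to the values of [r], [gap] bounds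
   its distance to their convex hull, and hence to the numerical range of the
   multiplication operators. *)
Definition gap (lam : C) (d : R) : Prop :=
  0 < d /\ (d <= `|Im lam| \/ d <= Re lam - N).

(** For [s > 0] the quotient [t / s] is a point of [[-N, N]], at distance at least [d] from [lam].
    The homogeneous form covers [s = 0] and serves both for values of [r] ([s = 1]) and for
    quadratic forms ([s = sqnorm u]). *)
Lemma gap_sqmod lam d (s t : R) : gap lam d -> 0 <= s -> `|t| <= N * s ->
  (d * s)%:C <= `|t%:C - lam * s%:C|.
Proof.
move=> [d0 lamd] s0; rewrite ler_norml => /andP[t1 t2].
have ds0 : 0 <= d * s by rewrite mulr_ge0// ltW.
rewrite norm_ge_sqmod//.
have -> : sqmod (t%:C - lam * s%:C) = (Re lam * s - t) ^+ 2 + (Im lam * s) ^+ 2.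
  by case: lam {lamd} => a b; rewrite /sqmod/=; ring.
case: lamd => [lamd|lamd].
  rewrite -[leLHS]add0r lerD ?sqr_ge0// !exprMn ler_wpM2r ?sqr_ge0//.
  by rewrite -[leRHS]real_normK ?num_real// lerXn2r// nnegrE// ltW.
have h := ler_wpM2r s0 lamd.
rewrite -[leLHS]addr0 lerD ?sqr_ge0// lerXn2r ?nnegrE//; lra.
Qed.

Lemma gap_far lam d : gap lam d -> far lam d.
Proof.
move=> H; split=> [|x]; first exact: H.1.
have := @gap_sqmod lam d 1 (r x) H ler01; rewrite !mulr1; apply.
exact: rN.
Qed.

Lemma gap_coercive lam d n (u : L2) : gap lam d ->
  d%:C * `|u| ^+ 2 <= `|L2_dot (mulL2 (scaled_mult n) u - lam *: u) u|.
Proof.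
move=> H; rewrite linearBl/= linearZl_LR/= norm_dotL2 L2_dotuu -rmorphM/=.
have [t -> tN] := @norm_dot_mulL2_real R (scaled_mult n) (fun x => r (n.+1%:R * x)) N u
  (fun=> erefl) (fun=> rN _).
apply: gap_sqmod => //; exact: Rintegral_ge0 (fun x _ => sqmod_ge0 _).
Qed.

Lemma gap_le lam d d' : 0 < d' -> d' <= d -> gap lam d -> gap lam d'.
Proof.
by move=> d'0 d'd [d0 [h|h]]; split=> //; [left|right]; apply: le_trans h.
Qed.

Lemma gap_near lam d h : gap lam d -> `|h| <= (d / 2)%:C -> gap (lam + h) (d / 2).
Proof.
move=> [d0 lamd] hd; have hR := normr_Re_le hd; have hI := normr_Im_le hd.
split; first by rewrite divr_gt0.
have [-> ->] : Re (lam + h) = Re lam + Re h /\ Im (lam + h) = Im lam + Im h.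
  by case: lam h {lamd hd hR hI} => [? ?] [? ?].
case: lamd => lamd; [left|right].
  by have := lerB_dist (Im lam) (- Im h); rewrite normrN opprK; lra.
by move: hR; rewrite ler_norml => /andP[]; lra.
Qed.

Lemma slit_gap lam : slit_domain N lam -> exists d, gap lam d.
Proof.
move=> [lam0|lamN].
  by exists `|Im lam|; split; [rewrite normr_gt0|left].
by exists (Re lam - N); split; [rewrite subr_gt0|right].
Qed.

Lemma gap_slit lam d : gap lam d -> slit_domain N lam.
Proof.
move=> [d0 [lamd|lamd]]; [left|right].
  by rewrite -normr_gt0 (lt_le_trans d0).
by rewrite -subr_gt0 (lt_le_trans d0).
Qed.

(** Every point has a positive [gap], half of which persists nearby; compactness turns this into a
    common one. *)
Lemma compact_gap (K : set (C : numFieldType)) : compact K -> K `<=` slit_domain N ->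
  exists2 d, 0 < d & forall lam, K lam -> gap lam d.
Proof.
rewrite compact_near_coveringP => cK KN.
have H (lam : (C : numFieldType)) : K lam -> \forall lam' \near lam & d \near (0 : R)^'+,
    gap lam' d.
  move=> /KN/slit_gap[d0 gd].
  have d2 : 0 < d0 / 2 by rewrite divr_gt0// gd.1.
  exists (ball lam (d0 / 2)%:C, [set t | 0 < t <= d0 / 2]) => /=.
    split; first by apply: (@nbhsx_ballx _ _ lam); rewrite ltcR.
    near=> t => /=; apply/andP; split; first by near: t; exact: nbhs_right_gt.
    by near: t; exact: nbhs_right_le.
  move=> [lam' t] /= [lamlam' /andP[t0 td]]; apply: (gap_le t0 td).
  rewrite -[lam'](subrK lam) addrC; apply: gap_near gd _.
  by rewrite distrC ltW.
have := cK _ _ _ (at_right_proper_filter _) H.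
move=> [d /= d0 hd]; exists (d / 2); first by rewrite divr_gt0.
move=> lam Klam; apply: (hd (d / 2)) => //=; last by rewrite divr_gt0.
by rewrite sub0r normrN gtr0_norm ?divr_gt0// ltr_pdivrMr// ltr_pMr// ltr1n.
Unshelve. all: by end_near. Qed.

End Gap.

Section WeakLimit.
Variable beta : nat -> T -> C.
Hypothesis betaE : forall n,
  \forall x \ae mu, Omega x -> beta n x = scaled_mult n x.
Local Notation a := (fun n => compress (mul_op (beta n))).

Lemma nneg_realc (z : C) : 0 <= z -> z = (Re z)%:C.
Proof. by move=> z0; rewrite RRe_real// ger0_real. Qed.

Lemma dot_CS_g0 (u v : g0) : `|g0_dot u v| <= `|u| * `|v|.
Proof. exact: dot_CS_L2. Qed.

Lemma weak_resolvent_estimate (phi psi : g0) (d e : R) : 0 < d -> 0 < e ->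
  exists n0 : nat, forall n lam, (n0 <= n)%N -> gap lam d ->
    `|g0_dot (mean_inv lam *: phi) psi - g0_dot (resolvent (a n) lam phi) psi| <= e%:C.
Proof.
(* [B] bounds the factor that multiplies the mean in [dot_resolvent_compress]: resolvent bound
   [1 / d], multiplier bound [N], and Cauchy-Schwarz against [psi]. [Re] is there because norms take
   values in [R[i]]. *)
move=> d0 e0; pose B : R := d^-1 * N * Re `|L2_one R| * Re `|psi|.
have N0 : 0 <= N by exact: le_trans (rN point).
have B0 : 0 <= B.
  by rewrite !mulr_ge0 ?invr_ge0 ?(ltW d0)// -ler0c -nneg_realc.
have e2 : 0 < e / 2 by rewrite divr_gt0.
have eB : 0 < e / 2 / (B + 1) by rewrite divr_gt0// ltr_wpDl.
have [n1 H1] := averaging_L2 (iota0 phi) (iota0 psi) d0 e2.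
have [n2 H2] := averaging_L2 (iota0 phi) (L2_one R) d0 eB.
exists (maxn n1 n2) => n lam; rewrite geq_max => /andP[nn1 nn2] gd.
have H := gap_far gd.
have coer u := gap_coercive n u gd.
have bc := inv_multP n H.
rewrite (dot_resolvent_compress bc d0 coer (betaE n)) linearZl_LR/=.
have -> : e%:C = (e / 2)%:C + (e / 2)%:C :> C.
  by rewrite -rmorphD; congr (_%:C); field.
rewrite opprD addrA (le_trans (ler_normB _ _))// lerD//.
  by rewrite distrC; exact: H1.
(* Averaging against [one] gives the limit [mean_inv lam * <phi, one>], which is 0 since [phi] has
   mean zero. *)
have := H2 n lam H nn2; rewrite g0_dot1 mulr0 subr0 normrM => s_le.
set rho := resolvent _ _ _.
have rho_le : `|g0_dot rho psi| <= B%:C.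
  apply: le_trans (dot_CS_g0 _ _) _; rewrite /B 3!rmorphM/= -!nneg_realc//.
  rewrite ler_wpM2r// -mulrA fmorphV/= mulrC ler_pdivlMr ?ltcR// mulrC.
  apply: le_trans (norm_resolvent_compress bc d0 coer (betaE n) _) _.
  by apply: le_trans (norm_iota0_adj _) _; exact: norm_mulL2.
apply: le_trans (ler_pM _ _ s_le rho_le) _ => //.
rewrite -rmorphM lecR mulrAC ler_pdivrMr ?ltr_wpDl//.
by rewrite ler_wpM2l ?(ltW e2)// lerDl.
Qed.

Lemma weak_resolvent_limit_mean_inv phi :
  weak_resolvent_limit (@g0_dot R) (slit_domain N) a phi (fun lam => mean_inv lam *: phi).
Proof.
split=> [lam /slit_gap[d /gap_far H]|psi K cK KN].
  exact: mean_inv_derivable H.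
have [d d0 Kd] := compact_gap cK KN.
move=> P /= /uniform_nbhs[E [entE EP]].
move: entE; rewrite -entourage_ballE => -[e /= e0 eE].
have eR := nneg_realc (ltW e0); pose e1 := Re e.
have e10 : 0 < e1 by rewrite -ltcR -eR.
have e2 : 0 < e1 / 2 by rewrite divr_gt0.
have [n0 Hn0] := weak_resolvent_estimate phi psi d0 e2.
exists n0 => // n /= nn0; apply: EP => lam Klam; apply: eE.
rewrite /ball/= (le_lt_trans (Hn0 n lam nn0 (Kd lam Klam)))// eR ltcR.
by rewrite ltr_pdivrMr// ltr_pMr// ltr1n.
Qed.

Lemma g0_dot_ext (u v : g0) : (forall w, g0_dot u w = g0_dot v w) -> u = v.
Proof.
move=> uv; apply/eqP; rewrite -subr_eq0; apply/eqP/(dot_norm0_eq0 (dot := @g0_dot R)).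
by rewrite /dot_norm linearBl/= uv subrr rootC0.
Qed.

(** Uniform convergence on the compact set [[set lam]] is pointwise convergence, and scalar limits
    are unique. *)
Lemma weak_resolvent_limit_uniq phi f lam :
  weak_resolvent_limit (@g0_dot R) (slit_domain N) a phi f -> slit_domain N lam ->
  f lam = mean_inv lam *: phi.
Proof.
move=> [_ f_lim] Nlam; apply: g0_dot_ext => psi.
have KN : [set lam] `<=` slit_domain N by move=> _ ->.
have cK : compact [set (lam : (C : numFieldType))] by exact: compact_set1.
have [_ m_lim] := weak_resolvent_limit_mean_inv phi.
have := f_lim psi _ cK KN; have := m_lim psi _ cK KN.
rewrite !uniform_set1 => ml fl.
exact: cvg_unique fl ml.
Qed.

End WeakLimit.
End HomogenizedResolvent.

(** * Value of the limit at 0 and holomorphic G-convergence *)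

Section Convergence.
Variable R : realType.
Local Notation C := R[i].
Local Notation T := (measurableTypeR R).
Local Notation mu := (@lebesgue_measure R).
Local Notation L2 := (L2 R).
Local Notation g0 := (g0 R).
Local Hint Resolve measurable_Omega : core.

(** Applied with [D] the slit domain and [x = 0]: the value at 0 of a holomorphic extension is
    determined by continuity, without an identity theorem. *)
Lemma continuous_closure_eq (U V : topologicalType) (D : set U) (f g : U -> V) (x : U) :
  hausdorff_space V -> closure D x -> (forall y, D y -> f y = g y) ->
  {for x, continuous f} -> {for x, continuous g} -> f x = g x.
Proof.
move=> hV Dx fg cf cg; apply: hV => A B fA gB.
have {}fA : nbhs x (f @^-1` A) by exact: cf.
have {}gB : nbhs x (g @^-1` B) by exact: cg.
have [y [Dy [Ay By]]] := Dx _ (filterI fA gB).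
by exists (f y); split=> //; rewrite fg.
Qed.

Lemma holomorphic_continuous (H : normedModType C) (D : set (C : numFieldType))
    (f : (C : numFieldType) -> H) z : holomorphic_on D f -> D z ->
  {for z, continuous (f : (C : numFieldType)^o -> H)}.
Proof. by move=> hf /hf Dz; apply: differentiable_continuous; exact/derivable1_diffP. Qed.

Lemma compress_oo : compress ([set 0] `*` [set: L2]) = [set p | p.1 = 0].
Proof.
apply/seteqP; split=> [[u v] [q [/= u0 _] _]|[u v]/= ->].
  exact: val_inj.
by exists (iota0 v) => //=; rewrite iota0_adjK.
Qed.

(** Only pairs with first entry 0 belong to the compressed relation, so subtracting [lam] does not
    change it, and its inverse is the zero operator on all of [g0]. *)
Lemma inner_spectrum_oo : inner_spectrum ([set 0] `*` [set: L2]) = set0.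
Proof.
apply/seteqP; split=> // lam; apply; rewrite /resolvent_set/= compress_oo.
exists (\0 : {linear g0 -> g0}); first exact: cst_continuous.
apply/seteqP; split=> [[u v]|[u v]/= ->].
  by move=> [[q1 q2] /= ->] [<- _].
by exists (0, u) => //=; rewrite scaler0 subr0.
Qed.

Lemma slit_domain_open (N : R) : open (slit_domain N : set (C : numFieldType)).
Proof.
rewrite openE => z /slit_gap[d gd].
apply: filterS (@nbhsx_ballx _ _ (z : (C : numFieldType)) (d / 2)%:C _); last first.
  by rewrite ltcR divr_gt0// gd.1.
move=> w zw; apply: (@gap_slit _ _ _ (d / 2)).
rewrite -[w](subrK z) addrC; apply: gap_near gd _.
by rewrite distrC ltW.
Qed.

Lemma slit_domain_closure0 (N : R) : closure (slit_domain N : set (C : numFieldType)) 0.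
Proof.
move=> B /nbhs_ballP[e /= e0 eB].
have eR := nneg_realc (ltW e0); have e10 : 0 < Re e by rewrite -ltcR -eR.
exists (0 +i* (Re e / 2)); split; first by left; rewrite /= gt_eqF// divr_gt0.
apply: eB; rewrite /ball/= sub0r normrN normc_def /= expr0n/= add0r sqrtr_sqr.
rewrite [X in _ < X]eR ltcR gtr0_norm ?divr_gt0//.
by rewrite ltr_pdivrMr// ltr_pMr// ltr1n.
Qed.

Variables (r : T -> R) (N delta : R).
Hypotheses (mr : measurable_fun [set: T] r) (rN : forall x, `|r x| <= N).
Hypothesis r_periodic : \forall x \ae mu, r ((x : R) + 1) = r x.
Hypotheses (delta_gt0 : 0 < delta) (delta_le : forall x, delta <= `|r x|).
Hypothesis rV_mean0 : \int[mu]_(x in @Omega R) (r x)^-1 = 0.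
Variable beta : nat -> T -> C.
Hypothesis beta_cmeasurable : forall n, cmeasurable (beta n).
Hypothesis betaE : forall n,
  \forall x \ae mu, Omega x -> beta n x = (r (n.+1%:R * x))%:C.
Local Notation a := (fun n => compress (mul_op (beta n))).

(** [gap] fails at 0, where the resolvents are not controlled; this weaker distance lets [mean_inv]
    continue there. *)
Lemma far0 : far r 0 delta.
Proof. by split=> // x; rewrite subr0 norm_realc lecR. Qed.

Lemma mean_inv_0 : mean_inv r 0 = 0.
Proof.
rewrite /mean_inv (_ : (fun x => _) = (fun x => ((r x)^-1)%:C)).
  by rewrite cint_real rV_mean0.
by apply/funext => x; rewrite subr0 fmorphV.
Qed.

Lemma G_graph_mean0 :
  G_graph (@g0_dot R) (slit_domain N) a = [set p | p.2 = 0].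
Proof.
apply/seteqP; split=> [[phi psi] [f flim]|[phi psi]/= ->] /=.
  move=> [U [g [oU U0 hg gf <-]]].
  transitivity (mean_inv r 0 *: phi); last by rewrite mean_inv_0 scale0r.
  apply: (@continuous_closure_eq ((C : numFieldType)^o) _ (slit_domain N)
    g (fun l => mean_inv r l *: phi)).
  - exact: norm_hausdorff.
  - exact: slit_domain_closure0.
  - move=> lam Nlam; rewrite gf//.
    exact: (@weak_resolvent_limit_uniq R r N mr rN r_periodic beta betaE phi f lam flim Nlam).
  - by apply: (holomorphic_continuous hg); right.
  - apply: (@holomorphic_continuous _ [set 0]) => // z ->.
    exact: mean_inv_derivable far0.
exists (fun lam => mean_inv r lam *: phi).
  exact: weak_resolvent_limit_mean_inv.
(* By [far_near], points within [delta / 2] of 0 stay at distance [delta / 2] from the values of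
   [r]. *)
exists (ball (0 : (C : numFieldType)) (delta / 2)%:C), (fun lam => mean_inv r lam *: phi).
split=> //.
- exact: ball_open.
- by apply: ballxx; rewrite ltcR divr_gt0.
- move=> z [/slit_gap[d /(gap_far rN) H]|z0].
    exact: mean_inv_derivable H.
  apply: (mean_inv_derivable mr (d := delta / 2)).
  rewrite -[z]add0r; apply: (far_near far0); rewrite ltW//.
  by move: z0; rewrite /ball/= sub0r normrN.
- by rewrite mean_inv_0 scale0r.
Qed.

Lemma hol_Gcvg_coef_mean0 :
  hol_Gcvg_coef (slit_domain N) beta ([set 0] `*` [set: L2]).
Proof.
have coer lam d n u (gd : gap N lam d) := gap_coercive mr rN n u gd.
split=> [n|].
  split; first exact: beta_cmeasurable.
  by exists N; apply: filterS (betaE n) => x bx Ox; rewrite bx// norm_realc lecR.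
exists (compress ([set 0] `*` [set: L2])) => //; split.
- by move=> n; apply: (bounded_operator_compress (b := scaled_mult mr rN n)); exact: betaE.
- split; [exact: slit_domain_open| |exact: slit_domain_closure0].
  move=> n lam /slit_gap[d gd]; have H := gap_far rN gd.
  exact: (resolvent_set_compress (inv_multP mr rN n H) gd.1
    (fun u => coer lam d n u gd) (betaE n)).
- move=> K cK KN; have [d d0 Kd] := compact_gap cK KN.
  exists d^-1 => n lam phi /Kd gd; have H := gap_far rN gd.
  rewrite fmorphV/= mulrC ler_pdivlMr ?ltcR// mulrC.
  exact: (norm_resolvent_compress (inv_multP mr rN n H) d0
    (fun u => coer lam d n u gd) (betaE n)).
- rewrite G_graph_mean0 => O [u Ou] _; exists u; split=> //=.
  by exists 0.
- by rewrite G_graph_mean0 compress_oo; apply/seteqP; split=> [[u v]|[u v]].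
Qed.

End Convergence.

(** * From essential bounds to bounds at every point, and the theorem *)

Section EssentialBounds.
Variable R : realType.
Local Notation T := (measurableTypeR R).
Local Notation mu := (@lebesgue_measure R).

Lemma lebesgue_setT_gt0 : (0 < mu [set: T])%E.
Proof.
apply: (@lt_le_trans _ _ (mu (@Omega R))); first by rewrite Omega1 lte01.
by apply: le_measure; rewrite ?inE//; exact: measurable_Omega.
Qed.

Lemma Lfun_oo_bound (f : T -> R) : f \in Lfun mu +oo%E ->
  measurable_fun [set: T] f /\
  (\forall x \ae mu, `|f x| <= fine ('N[mu]_+oo[EFin \o f])%E).
Proof.
rewrite inE => /andP[]; rewrite !inE /= => mf; rewrite /finite_norm => fy; split=> //.
have f0 := Lnorm_ge0 mu +oo (EFin \o f).
have ffin : ('N[mu]_+oo[EFin \o f])%E \is a fin_num by rewrite ge0_fin_numE.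
have := ess_sup_ge mu (abse \o (EFin \o f)).
(* The norm with exponent [+oo] unfolds to the essential supremum only if the whole space has
   positive measure. *)
have -> : ess_sup mu (abse \o (EFin \o f)) = 'N[mu]_+oo[EFin \o f]%E.
  by rewrite unlock lebesgue_setT_gt0.
by apply: filterS => x /=; rewrite -{1}(fineK ffin) lee_fin.
Qed.

End EssentialBounds.

(* The bounds [delta <= `|alpha| <= N] hold only almost everywhere; composing
   [alpha] with this function of its value makes them hold everywhere without
   losing periodicity. *)
Definition truncation (R : realType) (delta N t : R) : R :=
  if (delta <= `|t|) && (`|t| <= N) then t else N.

Lemma measurable_truncation (R : realType) (delta N : R) :
  measurable_fun [set: R] (truncation delta N).
Proof.
apply: measurable_fun_ifT => //.
by apply: measurable_and; apply: measurable_fun_ler => //; exact: measurableT_comp.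
Qed.

Theorem theorem2p7 (R : realType) (alpha : R -> R)
    (alpha_bounded : alpha \in Lfun (@lebesgue_measure R) +oo%E)
    (alpha_periodic :
      \forall x \ae (@lebesgue_measure R), alpha ((x : R) + 1) = alpha x)
    (alpha_neq0 : \forall x \ae (@lebesgue_measure R), alpha x != 0)
    (alphaV_bounded :
      (fun x => (alpha x)^-1) \in Lfun (@lebesgue_measure R) +oo%E)
    (alphaV_mean0 : \int[@lebesgue_measure R]_(x in `[0, 1]) (alpha x)^-1 = 0) :
  let norm_alpha := fine ('N[@lebesgue_measure R]_+oo[EFin \o alpha])%E in
  let alpha_oo := [set 0] `*` [set: L2 R] in
  hol_Gcvg_coef (slit_domain norm_alpha)
    (fun n x => (alpha (n.+1%:R * x))%:C) alpha_oo /\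
  inner_spectrum alpha_oo = set0.
Proof.
move=> N alpha_oo; split; last exact: inner_spectrum_oo.
have [malpha alphaN] := Lfun_oo_bound alpha_bounded.
have [malphaV alphaV] := Lfun_oo_bound alphaV_bounded.
(* [M] is the essential bound of [1 / alpha]; the absolute value and the summand 1 make the
   denominator positive at once. *)
set M := fine _ in alphaV; pose delta : R := (`|M| + 1)^-1.
have M1 : 0 < `|M| + 1 by rewrite ltr_wpDl.
have delta0 : 0 < delta by rewrite invr_gt0.
have good : \forall x \ae (@lebesgue_measure R), delta <= `|alpha x| <= N.
  have a0V := lebesgue_aeS2 (fun x a b => conj a b) alpha_neq0 alphaV.
  apply: lebesgue_aeS2 alphaN a0V => x aN [a0 aV]; rewrite aN andbT.
  rewrite -[leRHS]invrK lef_pV2 ?posrE ?invr_gt0 ?normr_gt0//.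
  by rewrite -normfV (le_trans aV)// (le_trans (ler_norm M))// lerDl.
pose r (x : measurableTypeR R) := truncation delta N (alpha x).
have alphar : \forall x \ae (@lebesgue_measure R), alpha x = r x.
  by apply: lebesgue_aeS good => x; rewrite /r /truncation => ->.
(* One point with both bounds yields [delta <= N], so that the default value [N] of [truncation]
   obeys them too. *)
have [x0 /andP[dx0 x0N]] : exists x, delta <= `|alpha x| <= N.
  exact: (@filter_ex _ _ (ae_properfilter_algebraOfSetsType (lebesgue_setT_gt0 R)) _ good).
have dN : delta <= N by exact: le_trans x0N.
have N0 : 0 <= N by rewrite (le_trans _ dN)// ltW.
have rN x : `|r x| <= N.
  by rewrite /r /truncation; case: ifPn => [/andP[]//|_]; rewrite ger0_norm.
have rdelta x : delta <= `|r x|.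
  by rewrite /r /truncation; case: ifPn => [/andP[]//|_]; rewrite ger0_norm.
have mr : measurable_fun [set: measurableTypeR R] r.
  by apply: measurableT_comp malpha; exact: measurable_truncation.
have mrV : measurable_fun [set: measurableTypeR R] (fun x => (r x)^-1).
  (* The real inverse is the complex one at [lam = 0], whose measurability is already known. *)
  rewrite (_ : (fun x => _) = (fun t => Re (t%:C - 0)^-1) \o r).
    by apply: measurableT_comp mr; exact: measurable_Re_inv.
  by apply/funext => x; rewrite [RHS]/comp subr0 -fmorphV.
apply: (@hol_Gcvg_coef_mean0 R r N delta) => //.
- by apply: lebesgue_aeS alpha_periodic => x ax; rewrite /r ax.
(* The mean is assumed over the closed interval but used over the open one; the booleans cover all
   choices of endpoints, each interval lying in [[0, 2[]. *)
- have rVi (i j : bool) : (@lebesgue_measure R).-integrable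
      [set` Interval (BSide i 0) (BSide j 1)] (EFin \o (fun x => (r x)^-1)).
    have : (@lebesgue_measure R).-integrable `[0, 2[ (EFin \o (fun x => (r x)^-1)).
      apply: (bounded_integrable_itv (M := delta^-1)) => // x.
      by rewrite normfV lef_pV2// posrE (lt_le_trans delta0).
    apply: integrableS => //; apply: subset_itv; first by case: i; rewrite bnd_simp.
    by case: j; rewrite bnd_simp ?ler1n ?ltr1n.
  rewrite /Omega Rintegral_itv_obnd_cbnd// Rintegral_itv_bndo_bndc//.
  rewrite -[RHS]alphaV_mean0 /Rintegral; congr fine; apply: ae_eq_integral => //.
  + by apply/measurable_EFinP; exact: measurable_funTS.
  + by apply/measurable_EFinP; exact: measurable_funTS.
  + by apply: lebesgue_aeS alphar => x ->.
- by move=> n; exact: scaled_cmeasurable malpha n.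
- move=> n; have n0 : (0 : R) < n.+1%:R by [].
  apply: lebesgue_aeS (ae_affine 0 n0 alphar) => x.
  by rewrite addr0 => ->.
Qed.
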